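(* Let $s\in(0,1/2)$, let $\Omega\subset\mathbb{R}^d$ be a bounded Lipschitz domain, let $g\in L^\infty(\mathbb{R}^d)$ have compact support, and assume $\mathrm{supp}(g)\subset\Lambda$ for the bounded set $\Lambda$ meshed by $\mathcal{T}_h$. Let $u\in\mathbb{V}^g$ be the solution of $a_u(u,v)=0$ for all $v\in\mathbb{V}^0$, and let $u_h\in\mathbb{V}^g_h$ be the solution of $a_{u_h}(u_h,v_h)=0$ for all $v_h\in\mathbb{V}_h^0$. Then $$e_s(u,u_h)\le\inf_{v_h\in\mathbb{V}_h^g}\left(2\,C_{d,s}\,K\iint_{Q_\Omega}\frac{|(u-v_h)(x)-(u-v_h)(y)|}{|x-y|^{d+2s}}\,dx\,dy\right)^{1/2}.$$
   Context: Constants and error quantity: $G_s(\rho)=\int_0^\rho(1+r^2)^{-(d+1+2s)/2}dr$, $K=\int_0^\infty(1+r^2)^{-(d+1+2s)/2}dr$, $C_{d,s}=\frac{1-2s}{\alpha_d}$ with $\alpha_d$ the volume of the $d$-dimensional unit ball, $d_v(x,y)=\frac{v(x)-v(y)}{|x-y|}$, and $$e_s(u,u_h)=\left(C_{d,s}\iint_{Q_\Omega}\big(G_s(d_u(x,y))-G_s(d_{u_h}(x,y))\big)\frac{d_{u-u_h}(x,y)}{|x-y|^{d-1+2s}}\,dx\,dy\right)^{1/2}.$$ Continuous setting: $\Omega^c=\mathbb{R}^d\setminus\Omega$ and $Q_\Omega=(\mathbb{R}^d\times\mathbb{R}^d)\setminus(\Omega^c\times\Omega^c)$. The space $\mathbb{V}^g$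 consists of the functions $v:\mathbb{R}^d\to\mathbb{R}$ with $v|_\Omega\in W^{2s}_1(\Omega)$, $v=g$ in $\Omega^c$, and $$|v|_{\mathbb{V}^g}:=\iint_{Q_\Omega}\frac{|v(x)-v(y)|}{|x-y|^{d+2s}}\,dx\,dy<\infty;$$ $\mathbb{V}^0$ is this space for $g=0$. The form is $$a_u(w,v)=\iint_{Q_\Omega}\widetilde G_s\Big(\frac{u(x)-u(y)}{|x-y|}\Big)\frac{(w(x)-w(y))(v(x)-v(y))}{|x-y|^{d+1+2s}}\,dx\,dy,\qquad \widetilde G_s(\rho)=\int_0^1(1+\rho^2r^2)^{-(d+1+2s)/2}dr,$$ so that $\rho\,\widetilde G_s(\rho)=G_s(\rho)$. Discrete setting: $\Lambda$ is a bounded set with $\mathrm{supp}(g)\subset\Lambda$ and $\overline\Omega$ contained in the interior of $\Lambda$. $\{\mathcal{T}_h\}_{h>0}$ is a family of conforming simplicial meshes (with closed elements) of $\Lambda$ which exactly mesh $\Omega$ (i.e. $\overline\Omega$ is a union of elements), and which is shape-regular: $\sigma=\sup_{h>0}\max_{T\in\mathcal{T}_h}h_T/\rho_T<\infty$, where $h_T=\mathrm{diam}(T)$ and $\rho_T$ is the diameter of the largest ball contained in $T$; $h=\max_{T\in\mathcal{T}_h}h_T$. For each vertex $x_i$ of $\mathcal{T}_h$, $\varphi_i$ is the piecewise linear Lagrange nodal basis function and $S_i=\mathrm{supp}(\varphi_i)$. $\mathcal{N}_h^c$ is the set of vertices lying in $\Omega^c$ (including those on $\partial\Omega$). Set $\mathbb{V}_h=\{v\in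 C(\Lambda): v|_T\in\mathcal{P}_1\ \forall T\in\mathcal{T}_h\}$. The exterior Clément interpolant is $\Pi_h^c g=\sum_{x_i\in\mathcal{N}_h^c}(\Pi_h^{x_i}g)(x_i)\varphi_i$, where for $x_i\in\mathcal{N}_h^c$, $\Pi_h^{x_i}g$ is the $L^2$-projection of $g|_{S_i\cap\Omega^c}$ onto $\mathcal{P}_1(S_i\cap\Omega^c)$. Set $\mathbb{V}_h^g=\{v\in\mathbb{V}_h: v|_{\Lambda\setminus\Omega}=\Pi_h^cg\}$ and let $\mathbb{V}_h^0$ be this space for $g=0$. Functions in $\mathbb{V}_h$ are extended by zero to $\mathbb{R}^d\setminus\Lambda$. *)

(* Defs.v *)
(* The reals are an arbitrary R : realType; the points of R^d are the row vectors
   'rV[R]_d, with their library topology. *)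
From HB Require Import structures.
From mathcomp Require Import all_boot all_order all_algebra.
From mathcomp Require Import all_classical all_reals all_analysis.

Set Implicit Arguments.
Unset Strict Implicit.
Unset Printing Implicit Defensive.

Import Order.TTheory GRing.Theory Num.Theory.
Import numFieldNormedType.Exports.

Local Open Scope classical_set_scope.
Local Open Scope ring_scope.

(* The sigma-algebra on R^n is generated by the coordinates, as the library does
   for n.-tuple; it is the Borel sigma-algebra. *)
Section measurable_rV.
Context (R : realType) (n : nat).

Let coord : 'I_n -> 'rV[R]_n -> R := fun i x => x 0 i.

Let rV_set0 : g_sigma_preimage coord set0.
Proof. exact: sigma_algebra0. Qed.

Let rV_setC A : g_sigma_preimage coord A -> g_sigma_preimage coord (~` A).
Proof. exact: sigma_algebraC. Qed.

Let rV_bigcup (F : _^nat) : (forall i, g_sigma_preimage coord (F i)) ->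
  g_sigma_preimage coord (\bigcup_i (F i)).
Proof. exact: sigma_algebra_bigcup. Qed.

HB.instance Definition _ := @isMeasurable.Build default_measure_display
  'rV[R]_n (g_sigma_preimage coord) rV_set0 rV_setC rV_bigcup.

End measurable_rV.

Lemma measurable_coord_rV (R : realType) n (i : 'I_n) :
  measurable_fun setT (fun x : 'rV[R]_n => x 0 i).
Proof.
move=> _ Y mY; rewrite setTI; apply: sub_sigma_algebra => /=.
rewrite -bigcup_seq/=; exists i => /=; first by rewrite mem_index_enum.
by exists Y => //; rewrite setTI.
Qed.

Lemma measurable_fun_rVP d (T : measurableType d) (R : realType) n
    (f : T -> 'rV[R]_n) :
  (forall i, measurable_fun setT (fun x => f x 0 i)) -> measurable_fun setT f.
Proof.
move=> mf _ Y mY; rewrite setTI.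
have sC : sigma_algebra setT [set A | measurable (f @^-1` A)].
  split => /=.
  - by rewrite preimage_set0.
  - by move=> A mA; rewrite setTD preimage_setC; exact: measurableC.
  - by move=> A mA; rewrite preimage_bigcup; exact: bigcupT_measurable.
apply: (smallest_sub sC _ mY) => A; rewrite -bigcup_seq => -[i /= _ [B mB <-]].
by rewrite /= setTI; have := mf i measurableT _ mB; rewrite setTI.
Qed.

Section lebesgue_rV.
Context (R : realType).

Definition cons_rV n (z : R * 'rV[R]_n) : 'rV[R]_n.+1 :=
  \row_(i < n.+1) oapp (z.2 0) z.1 (unlift ord0 i).

(* Lebesgue measure on R^n, as the n-fold product of Lebesgue measure on R. *)
Fixpoint lebesgue_rV n : set 'rV[R]_n -> \bar R :=
  match n with
  | 0%N => @dirac _ 'rV[R]_0 0 R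
  | n'.+1 => pushforward
      (@product_measure1 _ _ (measurableTypeR R) 'rV[R]_n' R
         lebesgue_measure (@lebesgue_rV n')) (@cons_rV n')
  end.

Let decons_rV n (x : 'rV[R]_n.+1) : measurableTypeR R * 'rV[R]_n :=
  (x 0 ord0, \row_(i < n) x 0 (lift ord0 i)).

Let cons_rVK n : cancel (@cons_rV n) (@decons_rV n).
Proof.
move=> [a y]; rewrite /decons_rV; congr (_, _).
  by rewrite mxE unlift_none.
by apply/rowP => i; rewrite !mxE liftK.
Qed.

Let measurable_decons_rV n : measurable_fun setT (@decons_rV n).
Proof.
apply/measurable_fun_pairP; split.
  exact: (@measurable_coord_rV R n.+1 ord0).
apply: measurable_fun_rVP => i.
rewrite (_ : (fun _ => _) = (fun x : 'rV[R]_n.+1 => x 0 (lift ord0 i))).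
  exact: measurable_coord_rV.
by apply/funext => x /=; rewrite mxE.
Qed.

Let measurable_cons_rV n :
  measurable_fun setT (@cons_rV n : measurableTypeR R * 'rV[R]_n -> _).
Proof.
apply: measurable_fun_rVP => i; rewrite /cons_rV.
under eq_fun do rewrite mxE.
case: unliftP => [j _|_] /=; last exact: measurable_fst.
apply: (@measurableT_comp _ _ _ _ _ _ (fun x : 'rV[R]_n => x 0 j)) => //.
exact: measurable_coord_rV.
Qed.

Let lebesgue_rV_measure n :
  exists m : {sigma_finite_measure set 'rV[R]_n -> \bar R},
    m = @lebesgue_rV n :> (set _ -> _).
Proof.
elim: n => [|n [m IH]] /=; first by exists (@dirac _ 'rV[R]_0 0 R).
rewrite -IH.
pose p : {measure set (measurableTypeR R * 'rV[R]_n)%type -> \bar R} :=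
  product_measure1 (@lebesgue_measure R) m.
have psf : sigma_finite setT p.
  have /sigma_finiteP[F [TF ndF Foo]] := sigma_finiteT (@lebesgue_measure R).
  have /sigma_finiteP[G [TG ndG Goo]] := sigma_finiteT m.
  exists (fun k => F k `*` G k) => [|k].
    rewrite -setXTT TF TG predeqE => -[x y]; split.
      move=> [/= [i _ Fix] [k _ Gky]]; exists (maxn i k) => //; split.
      - by move: x Fix; exact/subsetPset/ndF/leq_maxl.
      - by move: y Gky; exact/subsetPset/ndG/leq_maxr.
    by move=> [i _ []/= ? ?]; split; exists i.
  have [? ?] := Foo k; have [? ?] := Goo k.
  split; first exact: measurableX.
  by rewrite /p/= product_measure1E// lte_mul_pinfty// ge0_fin_numE.
pose q : {measure set 'rV[R]_n.+1 -> \bar R} :=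
  measure_function_pushforward__canonical__measure_function_Measure p
    (@measurable_cons_rV n).
have qsf : sigma_finite setT q.
  have [F TF Foo] := psf.
  have mF k : measurable (@decons_rV n @^-1` F k).
    have [mF _] := Foo k.
    by have := measurable_decons_rV measurableT mF; rewrite setTI.
  exists (fun k => @decons_rV n @^-1` F k) => [|k].
    by rewrite -preimage_bigcup -TF preimage_setT.
  split; first exact: mF.
  rewrite /= /pushforward -comp_preimage (_ : _ \o _ = id).
    by rewrite preimage_id; have [] := Foo k.
  by apply/funext => z; exact: cons_rVK.
pose sq := Measure_isSigmaFinite.Build _ _ _ q qsf.
pose q' : {sigma_finite_measure set 'rV[R]_n.+1 -> \bar R} :=
  HB.pack (q : set _ -> _) (Measure.class q) sq.
by exists q'.
Qed.

Let lebesgue_rV0 n : @lebesgue_rV n set0 = 0%E.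
Proof. by have [m <-] := lebesgue_rV_measure n; exact: measure0. Qed.

Let lebesgue_rV_ge0 n A : (0 <= @lebesgue_rV n A)%E.
Proof. by have [m <-] := lebesgue_rV_measure n; exact: measure_ge0. Qed.

Let lebesgue_rV_semi_sigma_additive n : semi_sigma_additive (@lebesgue_rV n).
Proof.
have [m <-] := lebesgue_rV_measure n; exact: measure_semi_sigma_additive.
Qed.

HB.instance Definition _ n := isMeasure.Build _ _ _ (@lebesgue_rV n)
  (lebesgue_rV0 n) (@lebesgue_rV_ge0 n) (@lebesgue_rV_semi_sigma_additive n).

Let lebesgue_rV_sigma_finite n : sigma_finite setT (@lebesgue_rV n).
Proof. by have [m <-] := lebesgue_rV_measure n; exact: sigma_finiteT. Qed.

HB.instance Definition _ n := @Measure_isSigmaFinite.Build _ _ _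
  (@lebesgue_rV n) (lebesgue_rV_sigma_finite n).

End lebesgue_rV.
Arguments lebesgue_rV {R n}.

Section euclidean.
Context {R : realType} {d : nat}.
Local Notation E := 'rV[R]_d.
Implicit Types (x y : E) (A : set E).

Definition dotp x y : R := \sum_(i < d) x 0 i * y 0 i.

(* The library norm on 'rV[R]_d is the sup norm; |x| in the text is this one. *)
Definition enorm x : R := Num.sqrt (dotp x x).

Definition eball x (r : R) : set E := [set y | enorm (y - x) <= r].

Definition diam A : R :=
  sup [set enorm (x.1 - x.2) | x in A `*` A].

Definition inball_diam A : R :=
  sup [set 2 * r | r in [set r | 0 <= r /\ exists x, eball x r `<=` A]].

(* Near each boundary point A is the strict epigraph, in some unit direction e, of
   a Lipschitz function gamma of the orthogonal projection onto e^perp. *)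
Definition lipschitz_boundary A := forall x0, (closure A `\` interior A) x0 ->
  exists (r : R) (e : E) (gamma : E -> R),
    [/\ 0 < r, enorm e = 1,
        exists L : R, L.-lipschitz_[set y | dotp y e = 0] gamma &
        forall x, eball x0 r x ->
          (A x <-> gamma (x - dotp x e *: e) < dotp x e)].

Definition bounded_lipschitz_domain A :=
  [/\ A !=set0, open A, connected A, bounded_set A & lipschitz_boundary A].

Definition ess_supp (g : E -> R) : set E :=
  [set x | forall U, open U -> U x ->
     ~ lebesgue_rV.-negligible [set y | U y /\ g y != 0]].

End euclidean.

Section constants.
Context {R : realType} (d : nat) (s : R).

Definition kern (r : R) : R := (1 + r ^+ 2) `^ (- ((d%:R + 1 + 2 * s) / 2)).

(* The integral from 0 to rho is oriented: rho may be negative. *)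
Definition Gs (rho : R) : R :=
  if 0 <= rho then \int[lebesgue_measure]_(r in `[0, rho]) kern r
  else - \int[lebesgue_measure]_(r in `[rho, 0]) kern r.

Definition Gs_tilde (rho : R) : R :=
  \int[lebesgue_measure]_(r in `[0, 1]) kern (rho * r).

Definition K_ds : R := \int[lebesgue_measure]_(r in `[0, +oo[) kern r.

Definition alpha_d : R := fine (lebesgue_rV (eball (0 : 'rV[R]_d) 1)).

Definition C_ds : R := (1 - 2 * s) / alpha_d.

End constants.

Section continuous_problem.
Context {R : realType} {d : nat} (s : R) (Omega : set 'rV[R]_d).
Local Notation E := 'rV[R]_d.
Local Notation lebesgue_rV2 := (@lebesgue_rV R d \x @lebesgue_rV R d)%E.
Implicit Types (u v w g : E -> R) (A : set (E * E)).

Definition Q_Omega : set (E * E) := ~` (~` Omega `*` ~` Omega).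

(* Quotients by |x - y| vanish on the (null) diagonal, as 0 has inverse 0. *)
Definition dquot v (z : E * E) : R := (v z.1 - v z.2) / enorm (z.1 - z.2).

Definition seminorm1 (sigma : R) A v : \bar R :=
  \int[lebesgue_rV2]_(z in A)
    (`|v z.1 - v z.2| / enorm (z.1 - z.2) `^ (d%:R + sigma))%:E.

(* Fractional Sobolev space of order sigma in ]0, 1[ and integrability 1. *)
Definition frac_sobolev1 (sigma : R) (D : set E) : set (E -> R) :=
  [set v | lebesgue_rV.-integrable D (EFin \o v) /\
           (seminorm1 sigma (D `*` D) v < +oo)%E].

Definition V_space g : set (E -> R) :=
  [set v | [/\ measurable_fun setT v, frac_sobolev1 (2 * s) Omega v,
      {ae lebesgue_rV, forall x, (~` Omega) x -> v x = g x} &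
      (seminorm1 (2 * s) Q_Omega v < +oo)%E]].

Definition a_form u w v : \bar R :=
  \int[lebesgue_rV2]_(z in Q_Omega)
    (Gs_tilde d s (dquot u z) * ((w z.1 - w z.2) * (v z.1 - v z.2) /
       enorm (z.1 - z.2) `^ (d%:R + 1 + 2 * s)))%:E.

Definition e_s u v : \bar R :=
  sqrte ((C_ds d s)%:E * \int[lebesgue_rV2]_(z in Q_Omega)
    ((Gs d s (dquot u z) - Gs d s (dquot v z)) *
       (dquot (u \- v) z / enorm (z.1 - z.2) `^ (d%:R - 1 + 2 * s)))%:E).

End continuous_problem.

(* A simplex is given by the matrix whose d+1 rows are its vertices, and a mesh by
   the list of its simplices. *)
Section mesh.
Context {R : realType} {d : nat}.
Local Notation E := 'rV[R]_d.
Implicit Types (T : 'M[R]_(d.+1, d)) (M : seq 'M[R]_(d.+1, d)).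

Definition affinely_independent T :=
  row_free (row_mx T (const_mx 1 : 'cV[R]_d.+1)).

(* Convex hull of the vertices with index in I. *)
Definition face T (I : {set 'I_d.+1}) : set E :=
  [set x | exists w : 'rV[R]_d.+1,
     [/\ forall i, 0 <= w 0 i, forall i, i \notin I -> w 0 i = 0,
         \sum_i w 0 i = 1 & x = w *m T]].

Definition element T : set E := face T [set: 'I_d.+1].

Definition union_of M : set E := \bigcup_(T in [set` M]) element T.

Definition vertices M : seq E := undup [seq row i T | T <- M, i <- enum 'I_d.+1].

Definition conforming_mesh (Lambda : set E) M :=
  [/\ forall T, T \in M -> affinely_independent T,
      forall T T', T \in M -> T' \in M -> exists I J,
        element T `&` element T' = face T I /\ face T I = face T' J &
      union_of M = Lambda].

Definition meshes_exactly (Omega : set E) M :=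
  exists2 M', {subset M' <= M} & union_of M' = closure Omega.

Definition mesh_size M : R := \big[Num.max/0]_(T <- M) diam (element T).

Definition shape_regular (H : set R) (Th : R -> seq 'M[R]_(d.+1, d)) :=
  (ereal_sup [set q | exists h T, [/\ H h, T \in Th h &
     q = (diam (element T) / inball_diam (element T))%:E]] < +oo)%E.

End mesh.

Section discrete_problem.
Context {R : realType} {d : nat} (Omega Lambda : set 'rV[R]_d)
  (M : seq 'M[R]_(d.+1, d)).
Local Notation E := 'rV[R]_d.
Implicit Types (v g : E -> R) (D : set E).

Definition P1 D : set (E -> R) :=
  [set v | exists (a : E) (b : R), forall x, D x -> v x = dotp a x + b].

(* Functions on Lambda, extended by zero. *)
Definition Vh : set (E -> R) :=
  [set v | [/\ {within Lambda, continuous v},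
      forall T, T \in M -> P1 (element T) v &
      forall x, ~ Lambda x -> v x = 0]].

Definition nodal_basis (xi : E) : E -> R :=
  xget (fun=> 0) [set phi | Vh phi /\
    forall xj, xj \in vertices M -> phi xj = (xj == xi)%:R].

Definition patch (xi : E) : set E := closure [set x | nodal_basis xi x != 0].

(* A polynomial is represented by an affine function on the whole of R^d, so that
   it can be evaluated anywhere; it is determined by its values on D as soon as D
   has positive measure. *)
Definition L2_proj_P1 D g : E -> R :=
  xget (fun=> 0) [set p | P1 setT p /\ forall q, P1 setT q ->
    (\int[lebesgue_rV]_(x in D) ((g x - p x) * q x)%:E = 0)%E].

Definition clement_ext g : E -> R := fun x =>
  \sum_(xi <- vertices M | xi \notin Omega)
    L2_proj_P1 (patch xi `&` ~` Omega) g xi * nodal_basis xi x.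

Definition Vh_space g : set (E -> R) :=
  [set v | Vh v /\ forall x, (Lambda `\` Omega) x -> v x = clement_ext g x].

End discrete_problem.

(* Main.v *)
(* For vh admissible put w := vh - uh, so that u - uh = (u - vh) + w. Since w is an
   admissible test function for both equations, its contribution to e_s(u, uh)^2 is
   a_u(u, w) - a_uh(uh, w) = 0; the remaining integrand is bounded by
   2 K |(u - vh)(x) - (u - vh)(y)| / |x - y|^(d + 2s) because |Gs| <= K.
   That w belongs to V^0 holds because w is bounded and Lipschitz (it is affine on each
   of finitely many closed simplices and vanishes outside Omega) and 2s < 1, so that
   min(L |x - y|, M) / |x - y|^(d + 2s) is integrable in y, uniformly in x; the integral
   is estimated on dyadic shells around x. *)
Require Import Defs.
From mathcomp Require Import all_boot all_order all_algebra.
From mathcomp Require Import all_classical all_reals all_analysis.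
From mathcomp Require Import measurable_realfun.
From mathcomp Require Import lra.

Set Implicit Arguments.
Unset Strict Implicit.
Unset Printing Implicit Defensive.

Import Order.TTheory GRing.Theory Num.Theory.
Import numFieldNormedType.Exports.

Local Open Scope classical_set_scope.
Local Open Scope ring_scope.

(** * The one-dimensional kernel *)

(** Two points need more than the energy computation. First, the discrete equation may be tested
    with w only if w equals the exterior interpolant of 0 on Lambda minus Omega. Basis functions and
    L2 projections are picked by choice, so that this interpolant is 0 has to be proved: the
    projection must be unique, hence patch minus Omega must have interior points. At a vertex on the
    boundary of Omega these come from the Lipschitz graph. Second, integrals are extended-valued, so
    splitting the error and cancelling the w part requires every product of [Gs] with a difference
    quotient to be integrable. The seminorm of u - vh may be infinite, and that case is settled
    separately. *)

Section kernel.
Context {R : realType} (d : nat) (s : R).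
Local Notation mu := (@lebesgue_measure R).
Local Notation kern := (kern d s).
Local Notation Gs := (Gs d s).
Local Notation Gs_tilde := (Gs_tilde d s).

Lemma kern_ge0 r : 0 <= kern r.
Proof. exact: powR_ge0. Qed.

Lemma kernN r : kern (- r) = kern r.
Proof. by rewrite /Defs.kern sqrrN. Qed.

Lemma continuous_kern : continuous kern.
Proof.
move=> x; apply: (@continuous_comp _ _ _ (fun r : R => 1 + r ^+ 2)
  (fun a => a `^ (- ((d%:R + 1 + 2 * s) / 2)))).
  exact: continuous_oneDsqr.
apply/differentiable_continuous/derivable1_diffP/derivable_powR.
by rewrite in_itv/= andbT ltr_pwDl// sqr_ge0.
Qed.

Lemma measurable_kern : measurable_fun setT kern.
Proof. by apply: continuous_measurable_fun; exact: continuous_kern. Qed.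

(** The exponent (d + 1 + 2s) / 2 is at least 1, so the derivative of the arctangent dominates
    [kern]; this is what makes K finite. *)
Lemma kern_le_oneDsqrV (r : R) : (0 < d)%N -> 0 < s -> kern r <= (oneDsqr r)^-1.
Proof.
move=> d0 s0; have e1 := oneDsqr_ge1 r.
have e0 : 0 <= oneDsqr r by apply: le_trans e1.
rewrite /Defs.kern -/(oneDsqr r) -(powR_inv1 e0).
apply: ler_powR => //; rewrite lerN2.
have : 1 <= d%:R :> R by rewrite ler1n.
lra.
Qed.

Hypotheses (d_gt0 : (0 < d)%N) (s_gt0 : 0 < s).

Lemma integrable_kern : mu.-integrable `[0, +oo[ (EFin \o kern).
Proof.
apply/integrableP; split.
  apply/measurable_EFinP; apply: measurable_funTS; exact: measurable_kern.
apply: (@le_lt_trans _ _ (pi / 2 : R)%:E); last by rewrite ltry.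
rewrite -integral0y_oneDsqr; apply: ge0_le_integral => //=.
- apply/measurable_EFinP/measurableT_comp => //; apply: measurable_funTS.
  exact: measurable_kern.
- apply/measurable_EFinP; apply: measurable_funTS => //.
  by apply: continuous_measurable_fun; exact: continuous_oneDsqrV.
- by move=> x _; rewrite lee_fin ger0_norm ?kern_ge0// kern_le_oneDsqrV.
Qed.

Lemma integral_kern_sym rho : rho <= 0 ->
  \int[mu]_(r in `[rho, 0]) kern r = \int[mu]_(r in `[0, - rho]) kern r.
Proof.
move=> r0; rewrite /Rintegral; congr fine.
have := @integration_by_substitution_oppr R kern 0 (- rho).
rewrite oppr0 opprK oppr_ge0 => /(_ r0 _) ->.
  by apply: eq_integral => x _ /=; rewrite kernN.
by apply: continuous_subspaceT => x; exact: continuous_kern.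
Qed.

Lemma GsN rho : Gs (- rho) = - Gs rho.
Proof.
rewrite /Defs.Gs oppr_ge0; case: (ltgtP rho 0) => [r0|r0|->].
- by rewrite integral_kern_sym ?opprK// ltW.
- by rewrite integral_kern_sym ?opprK// oppr_le0 ltW.
- by rewrite oppr0 set_itv1 Rintegral_set1 oppr0.
Qed.

Lemma Gs_tildeN rho : Gs_tilde (- rho) = Gs_tilde rho.
Proof.
by rewrite /Defs.Gs_tilde; apply: eq_Rintegral => r _; rewrite mulNr kernN.
Qed.

(** Substitution by r -> rho r on [0, 1]. It is increasing only for rho > 0; parity handles negative
    rho. *)
Let Gs_tildeE_gt0 (rho : R) : 0 < rho -> Gs rho = rho * Gs_tilde rho.
Proof.
move=> r0; rewrite /Defs.Gs ltW//.
have Fd : derive1 (fun x : R => rho * x) = cst rho.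
  by apply/funext => z; rewrite derive1E deriveZ//= derive_id /GRing.scale/= mulr1.
have sub : mu.-integrable `[0, 1] (EFin \o (fun r => kern (rho * r))).
  apply: continuous_compact_integrable; first exact: segment_compact.
  apply: continuous_subspaceT => x.
  apply: continuous_comp; last exact: continuous_kern.
  exact: mulrl_continuous.
rewrite /Defs.Gs_tilde -RintegralZl//.
have := @integration_by_substitution_increasing R (fun x => rho * x) kern 0 1 ler01.
rewrite mulr0 mulr1 Fd => sE; rewrite /Rintegral; congr fine.
rewrite sE.
- by apply: eq_integral => x _ /=; rewrite /= mulrC.
- by move=> x y _ _; rewrite ltr_pM2l.
- by move=> x _; exact: cvg_cst.
- exact: is_cvg_cst.
- exact: is_cvg_cst.
- split=> [x _||]; first exact: derivableM.
  + by apply: cvg_at_right_filter; exact: mulrl_continuous.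
  + by apply: cvg_at_left_filter; exact: mulrl_continuous.
- by apply: continuous_subspaceT => x; exact: continuous_kern.
Qed.

Lemma Gs_tildeE rho : Gs rho = rho * Gs_tilde rho.
Proof.
case: (ltgtP rho 0) => [r0|r0|->]; last 1 first.
- by rewrite mul0r /Defs.Gs lexx set_itv1 Rintegral_set1.
- by rewrite -[rho]opprK GsN Gs_tildeE_gt0 ?oppr_gt0// Gs_tildeN mulNr !opprK.
- exact: Gs_tildeE_gt0.
Qed.

(** Real integrals go through [fine], which sends +oo to 0, so monotonicity in the domain rests on
    the integrability of [kern]. *)
Let Rint_le (A B : set R) : measurable A -> measurable B -> A `<=` B ->
  B `<=` `[0, +oo[ ->
  \int[mu]_(r in A) kern r <= \int[mu]_(r in B) kern r.
Proof.
move=> mA mB AB B0.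
have iB : mu.-integrable B (EFin \o kern) by apply: integrableS integrable_kern.
have iA : mu.-integrable A (EFin \o kern) by apply: integrableS iB.
rewrite /Rintegral fine_le ?integrable_fin_num//.
apply: ge0_subset_integral => //; first by case/integrableP: iB.
by move=> x _; rewrite lee_fin kern_ge0.
Qed.

Lemma Gs_ge0 rho : 0 <= rho -> 0 <= Gs rho.
Proof.
by move=> r0; rewrite /Defs.Gs r0; apply: Rintegral_ge0 => x _; exact: kern_ge0.
Qed.

Let Gs_homo_ge0 x y : 0 <= x -> x <= y -> Gs x <= Gs y.
Proof.
move=> x0 xy; rewrite /Defs.Gs x0 (le_trans x0 xy); apply: Rint_le => //.
  exact: subset_itvl.
by apply: subset_itvl; rewrite bnd_simp.
Qed.

(** Monotonicity yields measurability of [Gs] directly. *)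
Lemma Gs_homo x y : x <= y -> Gs x <= Gs y.
Proof.
move=> xy; have [x0|x0] := leP 0 x; first exact: Gs_homo_ge0.
have [y0|y0] := leP y 0.
  by rewrite -[x]opprK -[y]opprK GsN (GsN (- y)) lerN2 Gs_homo_ge0 ?lerN2 ?oppr_ge0.
apply: (@le_trans _ _ 0); last by rewrite Gs_ge0// ltW.
by rewrite -[x]opprK GsN oppr_le0 Gs_ge0// oppr_ge0 ltW.
Qed.

Lemma measurable_Gs : measurable_fun setT Gs.
Proof. by apply: nondecreasing_measurable => // x y; exact: Gs_homo. Qed.

Lemma Gs_le_K rho : `|Gs rho| <= K_ds d s.
Proof.
wlog r0 : rho / 0 <= rho.
  move=> W; have [|r0] := leP 0 rho; first exact: W.
  by rewrite -normrN -GsN W// oppr_ge0 ltW.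
rewrite ger0_norm ?Gs_ge0// /Defs.Gs r0; apply: Rint_le => //.
by apply: subset_itvl; rewrite bnd_simp.
Qed.

Lemma K_ge0 : 0 <= K_ds d s.
Proof. exact: le_trans (normr_ge0 _) (Gs_le_K 0). Qed.

End kernel.

(** * Lebesgue measure on R^n *)

Section cube.
Context {R : realType}.

(** Closed sup-norm ball written by coordinates, which suits a sigma-algebra generated by
    coordinates and a measure built as a product. *)
Definition cube n (x : 'rV[R]_n) (r : R) : set 'rV[R]_n :=
  [set y | forall i, `|y 0 i - x 0 i| <= r].

Lemma nbhs_cubeP n (x : 'rV[R]_n) (U : set 'rV[R]_n) :
  nbhs x U <-> exists2 r, 0 < r & cube x r `<=` U.
Proof.
split=> [/nbhs_ballP[e /= e0 xU]|[r r0 xU]].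
  exists (e / 2); first by rewrite divr_gt0.
  move=> y xy; apply: xU; split=> // i j; rewrite ord1 /ball/= distrC.
  by apply: le_lt_trans (xy j) _; rewrite ltr_pdivrMr// ltr_pMr// ltr1n.
apply/nbhs_ballP; exists r => //= y [_ xy]; apply: xU => i.
by rewrite distrC; exact/ltW/xy.
Qed.

Lemma open_cubeP n (U : set 'rV[R]_n) :
  open U <-> forall x, U x -> exists2 r, 0 < r & cube x r `<=` U.
Proof.
by rewrite openE; split=> H x /H /nbhs_cubeP.
Qed.

Lemma measurable_cube n (x : 'rV[R]_n) (r : R) : measurable (cube x r).
Proof.
have -> : cube x r = \bigcap_(i in [set: 'I_n]) [set y | `|y 0 i - x 0 i| <= r].
  by apply/seteqP; split=> [y xy i _|y xy i]; exact: xy.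
apply: fin_bigcap_measurable => // i _.
rewrite -[X in measurable X]setTI; apply: measurable_fun_le => //.
apply: measurableT_comp => //; apply: measurable_funB => //.
exact: measurable_coord_rV.
Qed.

Lemma lebesgue_rV_cube n (x : 'rV[R]_n) (r : R) : 0 <= r ->
  lebesgue_rV (cube x r) = ((2 * r) ^+ n)%:E.
Proof.
move=> r0; elim: n => [|n IH] in x *.
  by rewrite /= diracE mem_set// => -[].
rewrite /= /pushforward (_ : _ @^-1` _ = `[x 0 ord0 - r, x 0 ord0 + r] `*`
    cube (\row_i x 0 (lift ord0 i)) r); last first.
  apply/seteqP; split=> -[a y] /=.
    move=> xy; split=> [|i].
      by have := xy ord0; rewrite /cons_rV mxE unlift_none/= in_itv/= ler_distl.
    by have := xy (lift ord0 i); rewrite /cons_rV !mxE liftK.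
  rewrite in_itv/= => -[xa xy] i; rewrite /cons_rV mxE.
  case: unliftP => [j ->|->] /=; first by have := xy j; rewrite mxE.
  by rewrite ler_distl.
rewrite product_measure1E//; last exact: measurable_cube.
transitivity (@lebesgue_measure R `[(x 0 ord0 - r)%R, (x 0 ord0 + r)%R] *
  lebesgue_rV (cube (\row_i x 0%R (lift ord0 i)) r))%E => //.
rewrite lebesgue_measure_itv/= IH lte_fin.
(* The interval formula separates off degenerate intervals: there r = 0 and both sides are 0. *)
case: ltP => [_|].
  by rewrite -EFinB -EFinM exprS; congr (_ * _)%:E; lra.
rewrite lerBrDr -addrA gerDl => r0'.
have -> : r = 0 by lra.
by rewrite mul0e mulr0 expr0n.
Qed.

Lemma open_measurable_rV n (U : set 'rV[R]_n) : open U -> measurable U.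
Proof.
move/open_cubeP => oU.
pose B (qr : 'rV[rat]_n * rat) := cube (map_mx ratr qr.1) (ratr qr.2 : R).
rewrite (_ : U = \bigcup_(qr in [set qr | B qr `<=` U]) B qr).
  rewrite bigcup_mkcond; apply: countable_bigcupT_measurable => // qr.
  by case: ifP => // _; exact: measurable_cube.
apply/seteqP; split=> [x /oU[r r0 xU]|x [qr BU Bx]]; last exact: BU.
(* A rational radius p < r / 2 and a rational centre within p of x give a cube that contains x and
   stays within 2p < r of it. *)
have [p] := rat_in_itvoo (divr_gt0 r0 (ltr0Sn R 1)).
rewrite in_itv/= => /andP[p0 pr].
have q i : {a : rat | `|x 0 i - ratr a| <= ratr p}.
  apply: cid; have [|a] := @rat_in_itvoo R (x 0 i - ratr p) (x 0 i + ratr p).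
    lra.
  by rewrite in_itv/= => xa; exists a; rewrite ler_distl; lra.
exists (\row_i sval (q i), p) => [|i /=]; last by rewrite !mxE; case: (q i).
move=> y Bxy; apply: xU => i; have := Bxy i; rewrite /= !mxE.
case: (q i) => a /=; rewrite !ler_distl; lra.
Qed.

Lemma closed_measurable_rV n (U : set 'rV[R]_n) : closed U -> measurable U.
Proof.
by move/closed_openC/open_measurable_rV/measurableC; rewrite setCK.
Qed.

Lemma open_not_negligible n (U : set 'rV[R]_n) : open U -> U !=set0 ->
  ~ lebesgue_rV.-negligible U.
Proof.
move=> /open_cubeP oU [x /oU[r r0 xU]] /(negligibleS xU).
move/negligibleP => /(_ (measurable_cube x r)).
rewrite [LHS](lebesgue_rV_cube x (ltW r0)).
by case=> /eqP; apply/negP; rewrite expf_neq0// mulf_neq0// ?pnatr_eq0// gt_eqF.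
Qed.

End cube.

(** * Euclidean norm compared with coordinates, sup norm and cubes *)

Section enorm.
Context {R : realType} {d : nat}.
Local Notation E := 'rV[R]_d.
Implicit Types x y : E.

Lemma enorm_ge0 x : 0 <= enorm x.
Proof. exact: sqrtr_ge0. Qed.

Lemma dotp_ge0 x : 0 <= dotp x x.
Proof. by apply: sumr_ge0 => i _; rewrite -expr2 sqr_ge0. Qed.

Lemma enormN x : enorm (- x) = enorm x.
Proof.
rewrite /enorm; congr Num.sqrt; apply: eq_bigr => i _.
by rewrite !mxE mulrNN.
Qed.

Lemma enormB x y : enorm (x - y) = enorm (y - x).
Proof. by rewrite -enormN opprB. Qed.

Lemma coord_le_enorm x i : `|x 0 i| <= enorm x.
Proof.
rewrite -sqrtr_sqr ler_wsqrtr// /dotp (bigD1 i)//= -expr2 lerDl.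
by apply: sumr_ge0 => j _; rewrite -expr2 sqr_ge0.
Qed.

Lemma norm_le_enorm x : `|x| <= enorm x.
Proof.
rewrite [leLHS]/Num.norm/= mx_normrE; apply/bigmax_leP; split.
  exact: enorm_ge0.
by move=> [i j] _ /=; rewrite ord1 coord_le_enorm.
Qed.

Lemma coord_le_norm x i : `|x 0 i| <= `|x|.
Proof.
rewrite [leRHS]/Num.norm/= mx_normrE.
exact: (le_bigmax _ (fun ij => `|x ij.1 ij.2|) (0, i)).
Qed.

Lemma enorm_cube x y (r : R) : 0 <= r -> cube x r y -> enorm (y - x) <= d%:R * r.
Proof.
move=> r0 xy; rewrite -(ger0_norm (mulr_ge0 (ler0n _ _) r0)) -sqrtr_sqr.
rewrite ler_wsqrtr//; apply: (@le_trans _ _ (\sum_(i < d) r ^+ 2)).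
  apply: ler_sum => i _; rewrite -expr2 -real_normK ?num_real// ler_sqr ?nnegrE//.
  by rewrite !mxE.
rewrite sumr_const card_ord exprMn -[leLHS]mulr_natl ler_wpM2r ?sqr_ge0//.
by rewrite -natrX ler_nat; case: (d) => // n; rewrite leq_pmulr.
Qed.

Lemma measurable_enorm : measurable_fun setT (@enorm R d).
Proof.
apply: (@measurableT_comp _ _ _ _ _ _ (@Num.sqrt R)).
  by apply: nondecreasing_measurable => // a b; exact: ler_wsqrtr.
apply: measurable_sum => i; apply: measurable_funM; exact: measurable_coord_rV.
Qed.

Lemma measurable_subrV : measurable_fun setT (fun z : E * E => z.1 - z.2).
Proof.
apply: measurable_fun_rVP => i.
under eq_fun do rewrite !mxE.
apply: measurable_funB;
  apply: (measurableT_comp (@measurable_coord_rV R d i)).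
  exact: measurable_fst.
exact: measurable_snd.
Qed.

Lemma measurable_enormB :
  measurable_fun setT (fun z : E * E => enorm (z.1 - z.2)).
Proof. exact: measurableT_comp measurable_enorm measurable_subrV. Qed.

End enorm.

(** * Lipschitz functions have finite seminorm *)

Section dyadic.
Context {R : realType}.

(** Locates the dyadic shell of a distance; distances below 1 are treated through their inverse. *)
Lemma dyadic_ge1 (e : R) : 1 <= e ->
  exists k : nat, 2 `^ k%:R <= e <= 2 `^ (k%:R + 1).
Proof.
move=> e1; have ex : exists i, e <= 2 ^+ i.
  by exists (Num.bound e); exact/ltW/upper_nthrootP.
case: (ex_minnP ex) => -[|k] ek kmin.
  exists 0%N; rewrite powRr0 e1 add0r powRr1//.
  by apply: le_trans ek _; rewrite expr0 ler1n.
exists k; rewrite natr1 !powR_mulrn// ek andbT.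
by rewrite leNgt; apply/negP => /ltW/kmin; rewrite ltnn.
Qed.

Lemma nneseries_geometric_le (a q : R) : 0 <= a -> 0 < q < 1 ->
  (\sum_(k <oo) (a * q ^+ k)%:E <= (a / (1 - q))%:E)%E.
Proof.
move=> a0 /andP[q0 q1]; apply: lime_le.
  by apply: is_cvg_nneseries => k _ _; rewrite lee_fin mulr_ge0 ?exprn_ge0// ltW.
apply: nearW => n; rewrite sumEFin lee_fin.
by have := @geometric_le_lim R n a q a0 q0; apply; rewrite ger0_norm ?ltW.
Qed.

(** The function is dominated by two series of multiples of indicators of cubes, integrated term by
    term. Whole cubes may replace shells because all terms are nonnegative. One family serves the
    shells shrinking to x, the other those going to infinity. *)
Lemma integral_cubes_le n (x : 'rV[R]_n) (f : 'rV[R]_n -> \bar R)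
    (r1 c1 r2 c2 : nat -> R) :
  measurable_fun setT f -> (forall y, 0 <= f y)%E ->
  (forall k, 0 <= r1 k) -> (forall k, 0 <= c1 k) ->
  (forall k, 0 <= r2 k) -> (forall k, 0 <= c2 k) ->
  (forall y, [\/ f y = 0%E, exists2 k, cube x (r1 k) y & (f y <= (c1 k)%:E)%E |
                exists2 k, cube x (r2 k) y & (f y <= (c2 k)%:E)%E]) ->
  (\int[lebesgue_rV]_y f y <= \sum_(k <oo) (c1 k * (2 * r1 k) ^+ n)%:E +
     \sum_(k <oo) (c2 k * (2 * r2 k) ^+ n)%:E)%E.
Proof.
move=> mf f0 r10 c10 r20 c20 fc.
pose F (c r : nat -> R) k (y : 'rV[R]_n) : \bar R :=
  ((c k)%:E * (\1_(cube x (r k)) y)%:E)%E.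
have mF c r k : measurable_fun setT (F c r k).
  apply: measurable_funeM; apply/measurable_EFinP.
  by apply: measurable_indic; exact: measurable_cube.
have F0 c r k y : (forall i, 0 <= c i) -> (0 <= F c r k y)%E.
  by move=> c0; rewrite mule_ge0// lee_fin.
have IF c r : (forall i, 0 <= c i) -> (forall i, 0 <= r i) ->
    (\int[lebesgue_rV]_y \sum_(k <oo) F c r k y =
     \sum_(k <oo) (c k * (2 * r k) ^+ n)%:E)%E.
  move=> c0 r0; rewrite integral_nneseries//; last by move=> k y _; exact: F0.
  apply: eq_eseriesr => k _; rewrite ge0_integralZl_EFin//.
  - rewrite integral_indic//; last exact: measurable_cube.
    rewrite setIT EFinM; congr (_ * _)%E.
    exact: lebesgue_rV_cube.
  - by apply/measurable_EFinP; apply: measurable_indic; exact: measurable_cube.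
have F_le c r k y : (forall i, 0 <= c i) -> cube x (r k) y ->
    ((c k)%:E <= \sum_(k <oo) F c r k y)%E.
  move=> c0 xy; rewrite (@nneseriesD1 _ _ k)//; last by move=> i _; exact: F0.
  rewrite [X in (_ <= X + _)%E]/F indicE mem_set// mule1 leeDl//.
  by apply: nneseries_ge0 => i _ _; exact: F0.
have S0 c r y : (forall i, 0 <= c i) -> (0 <= \sum_(k <oo) F c r k y)%E.
  by move=> c0; apply: nneseries_ge0 => i _ _; exact: F0.
have mS c r : (forall i, 0 <= c i) ->
    measurable_fun setT (fun y => \sum_(k <oo) F c r k y)%E.
  by move=> c0; apply: ge0_emeasurable_sum => // k y _ _; exact: F0.
rewrite -(IF c1 r1)// -(IF c2 r2)// -ge0_integralD//; last 4 first.
- by move=> y _; exact: S0.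
- exact: mS.
- by move=> y _; exact: S0.
- exact: mS.
apply: ge0_le_integral => //.
- by apply: emeasurable_funD; exact: mS.
move=> y _; case: (fc y) => [->|[k xy fk]|[k xy fk]].
- by rewrite adde_ge0// S0.
- by rewrite (le_trans fk)// (le_trans (F_le _ _ _ _ _ xy))// leeDl// S0.
- by rewrite (le_trans fk)// (le_trans (F_le _ _ _ _ _ xy))// leeDr// S0.
Qed.

(* The kernel dominates [`|v x - v y| / enorm (x - y) `^ (n + a)] for every bounded
   Lipschitz function v; the hypothesis [a < 1] makes it integrable at [x]. *)
Definition lip_kernel n (a L M : R) (x y : 'rV[R]_n) : R :=
  Num.min (L * enorm (x - y)) M / enorm (x - y) `^ (n%:R + a).

Lemma lip_kernel_ge0 n a L M (x y : 'rV[R]_n) : 0 <= L -> 0 <= M ->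
  0 <= lip_kernel a L M x y.
Proof.
move=> L0 M0; rewrite mulr_ge0 ?invr_ge0 ?powR_ge0// le_min M0 andbT.
by rewrite mulr_ge0// enorm_ge0.
Qed.

Lemma measurable_lip_kernel n a L M :
  measurable_fun setT (fun z : 'rV[R]_n * 'rV[R]_n => lip_kernel a L M z.1 z.2).
Proof.
apply: measurable_funM.
  apply: measurable_minr => //; apply: measurable_funM => //.
  exact: measurable_enormB.
under eq_fun do rewrite -powRN.
apply: (@measurableT_comp _ _ _ _ _ _ (fun e : R => e `^ (- (n%:R + a)))) => //.
exact: measurable_enormB.
Qed.

Let two_powD (b c : R) : 2 `^ b * 2 `^ c = 2 `^ (b + c).
Proof. by rewrite powRD// pnatr_eq0 implybT. Qed.

Let two_powS (b : R) : 2 * 2 `^ b = 2 `^ (1 + b).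
Proof. by rewrite -two_powD powRr1. Qed.

Let two_powX (b : R) (k : nat) : (2 `^ b) ^+ k = 2 `^ (k%:R * b).
Proof. by rewrite mulrC powRrM powR_mulrn ?powR_ge0. Qed.

(** Bound times volume is geometric in k: near x, where the kernel is at most L e^(1 - n - a), the
    ratio is 2^(a - 1); far away, where it is at most M e^(- n - a), the ratio is 2^(- a). So a < 1
    is used near x and a > 0 at infinity. The shells are centred at x, hence C does not depend on
    x. *)
Lemma integral_lip_kernel n (a L M : R) (n_gt0 : (0 < n)%N) (a01 : 0 < a < 1)
    (L0 : 0 <= L) (M0 : 0 <= M) :
  exists C : R, forall x : 'rV[R]_n,
    (\int[lebesgue_rV]_y (lip_kernel a L M x y)%:E <= C%:E)%E.
Proof.
have [a0 a1] := andP a01.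
have n1 : 1 <= n%:R :> R by rewrite ler1n.
pose p : R := n%:R - 1 + a; pose q : R := n%:R + a.
pose A1 := L * 2 `^ (p + n%:R); pose A2 := M * 2 `^ (2 * n%:R).
have A10 : 0 <= A1 by rewrite mulr_ge0 ?powR_ge0.
have A20 : 0 <= A2 by rewrite mulr_ge0 ?powR_ge0.
have lt1 (b : R) : b < 0 -> 0 < (2 : R) `^ b < 1.
  move=> b0; rewrite powR_gt0//= -[ltRHS](powRr0 2).
  by rewrite /powR pnatr_eq0/= ltr_expR ltr_pM2r// ln_gt0// ltr1n.
exists (A1 / (1 - 2 `^ (a - 1)) + A2 / (1 - 2 `^ (- a))) => x.
apply: le_trans (@integral_cubes_le n x _
  (fun k => 2 `^ (- k%:R)) (fun k => L * 2 `^ ((k%:R + 1) * p))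
  (fun k => 2 `^ (k%:R + 1)) (fun k => M * 2 `^ (- (k%:R * q))) _ _ _ _ _ _ _) _.
- apply/measurable_EFinP.
  exact: measurableT_comp (measurable_lip_kernel a L M) (pair1_measurable x).
- by move=> y; rewrite lee_fin lip_kernel_ge0.
- by move=> k; exact: powR_ge0.
- by move=> k; rewrite mulr_ge0 ?powR_ge0.
- by move=> k; exact: powR_ge0.
- by move=> k; rewrite mulr_ge0 ?powR_ge0.
- move=> y; rewrite /lip_kernel; set e := enorm (x - y).
  have yx r : e <= r -> cube x r y.
    move=> er i; apply: le_trans er; rewrite /e enormB.
    by have := coord_le_enorm (y - x) i; rewrite !mxE.
  have : 0 <= e by exact: enorm_ge0.
  rewrite le_eqVlt => /predU1P[<-|e0].
    by constructor 1; rewrite mulr0 min_l// mul0r.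
  have [e1|e1] := leP e 1; last first.
    have [k /andP[ke ek]] := dyadic_ge1 (ltW e1).
    constructor 3; exists k; first exact: yx.
    rewrite lee_fin; apply: ler_pM => //.
    - by rewrite le_min M0 andbT mulr_ge0// ltW.
    - by rewrite invr_ge0 powR_ge0.
    - by rewrite ge_min lexx orbT.
    rewrite powRN lef_pV2 ?posrE ?powR_gt0// powRrM.
    by apply: ge0_ler_powR => //; rewrite ?nnegrE ?powR_ge0// /q; lra.
  have [|k /andP[ke ek]] := @dyadic_ge1 e^-1; first by rewrite invf_ge1.
  constructor 2; exists k.
    by apply: yx; rewrite powRN -[e]invrK lef_pV2// posrE ?powR_gt0 ?invr_gt0.
  rewrite lee_fin; apply: (@le_trans _ _ (L * (e / e `^ q))).
    rewrite mulrA ler_wpM2r ?invr_ge0 ?powR_ge0//.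
    by rewrite ge_min lexx.
  apply: ler_wpM2l => //.
  have -> : e / e `^ q = e^-1 `^ p.
    rewrite -[in RHS](powR_inv1 (ltW e0)) -powRrM -powRN.
    rewrite -[X in X * _](powRr1 (ltW e0)) -powRD; last by rewrite (gt_eqF e0) implybT.
    by congr (_ `^ _); rewrite /p /q; lra.
  rewrite powRrM; apply: ge0_ler_powR => //; rewrite ?nnegrE ?powR_ge0 ?invr_ge0//.
    by rewrite /p; lra.
  exact: ltW.
rewrite EFinD; apply: leeD.
  apply: le_trans (nneseries_geometric_le A10 (lt1 (a - 1) _)); last by lra.
  rewrite le_eqVlt; apply/orP; left; apply/eqP; apply: eq_eseriesr => k _.
  congr EFin; rewrite /A1 -!mulrA two_powS !two_powX !two_powD; congr (L * _).
  by congr (_ `^ _); rewrite /p; nra.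
apply: le_trans (nneseries_geometric_le A20 (lt1 (- a) _)); last by lra.
rewrite le_eqVlt; apply/orP; left; apply/eqP; apply: eq_eseriesr => k _.
congr EFin; rewrite /A2 -!mulrA two_powS !two_powX !two_powD; congr (M * _).
by congr (_ `^ _); rewrite /q; nra.
Qed.

End dyadic.

Section finiteness.
Context {R : realType} {d : nat} (s : R) (Omega : set 'rV[R]_d).
Local Notation E := 'rV[R]_d.
Local Notation mu := (@lebesgue_rV R d).

Lemma bounded_set_cube (A : set E) : bounded_set A ->
  exists2 r : R, 0 < r & A `<=` cube 0 r.
Proof.
case=> m [_ Am]; exists (`|m| + 1); first by rewrite ltr_pwDr.
move=> x Ax i; rewrite mxE subr0; apply: le_trans (coord_le_norm x i) _.
by apply: (Am (`|m| + 1)) => //; rewrite ltr_pwDr// ler_norm.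
Qed.

Lemma bounded_lebesgue_fin (A : set E) : bounded_set A -> measurable A ->
  (mu A < +oo)%E.
Proof.
move=> /bounded_set_cube[r r0 Ar] mA.
apply: (@le_lt_trans _ _ (mu (cube 0 r))).
  by apply: le_measure => //; rewrite inE//; exact: measurable_cube.
have -> : mu (cube 0 r) = ((2 * r) ^+ d)%:E by exact/lebesgue_rV_cube/ltW.
by rewrite ltry.
Qed.

Lemma measurable_Q_Omega : measurable Omega -> measurable (Q_Omega Omega).
Proof. by move=> mO; apply: measurableC; apply: measurableX; exact: measurableC. Qed.

(** Q is covered by the pairs with first point in Omega and those with second point in Omega. By
    Tonelli and the symmetry of the kernel, each part contributes at most C times the finite measure
    of Omega. *)
Lemma seminorm1_lip_fin (v : E -> R) (L M : R) :
  (0 < d)%N -> 0 < s < 1 / 2 -> 0 <= L -> 0 <= M ->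
  bounded_set Omega -> measurable Omega -> measurable_fun setT v ->
  (forall x y, `|v x - v y| <= L * enorm (x - y)) ->
  (forall x y, `|v x - v y| <= M) ->
  (seminorm1 (2 * s) (Q_Omega Omega) v < +oo)%E.
Proof.
move=> d0 s01 L0 M0 bO mO mv vL vM.
have [|C HC] := @integral_lip_kernel R d (2 * s) L M d0 _ L0 M0; first lra.
pose k (z : E * E) := lip_kernel (2 * s) L M z.1 z.2.
have k0 z : 0 <= k z by exact: lip_kernel_ge0.
have mk : measurable_fun setT k by exact: measurable_lip_kernel.
have C0 : 0 <= C.
  rewrite -lee_fin; apply: le_trans (HC 0); apply: integral_ge0 => y _.
  by rewrite lee_fin lip_kernel_ge0.
pose g1 (z : E * E) := (k z * \1_Omega z.1)%:E.
pose g2 (z : E * E) := (k z * \1_Omega z.2)%:E.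
have m1O : measurable_fun setT (\1_Omega : E -> R) by exact: measurable_indic.
have mg1 : measurable_fun setT g1.
  apply/measurable_EFinP; apply: measurable_funM => //.
  exact: (measurableT_comp m1O measurable_fst).
have mg2 : measurable_fun setT g2.
  apply/measurable_EFinP; apply: measurable_funM => //.
  exact: (measurableT_comp m1O measurable_snd).
have g10 z : (0 <= g1 z)%E by rewrite lee_fin mulr_ge0.
have g20 z : (0 <= g2 z)%E by rewrite lee_fin mulr_ge0.
have finO : (C%:E * mu Omega < +oo)%E.
  have := bounded_lebesgue_fin bO mO.
  rewrite -ge0_fin_numE// => fO.
  by rewrite -ge0_fin_numE ?mule_ge0// fin_numM.
have int1O : (\int[mu]_x (C * \1_Omega x)%:E = C%:E * mu Omega)%E.
  under eq_integral do rewrite EFinM.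
  rewrite ge0_integralZl_EFin//; last exact/measurable_EFinP.
  by rewrite integral_indic// setIT.
have I1 : (\int[mu \x mu]_z g1 z < +oo)%E.
  rewrite fubini_tonelli1//; apply: le_lt_trans finO; rewrite -int1O.
  apply: ge0_le_integral => //.
  - by move=> x _; apply: integral_ge0.
  - exact: measurable_fun_fubini_tonelli_F.
  - by apply/measurable_EFinP; apply: measurable_funM.
  move=> x _; rewrite /fubini_F /g1 /=.
  under eq_integral do rewrite EFinM muleC.
  rewrite ge0_integralZl_EFin//.
  - rewrite muleC EFinM; apply: lee_wpmul2r; [by rewrite lee_fin|exact: HC].
  - by move=> y _; rewrite lee_fin.
  - by apply/measurable_EFinP; exact: measurableT_comp mk (pair1_measurable x).
have I2 : (\int[mu \x mu]_z g2 z < +oo)%E.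
  rewrite fubini_tonelli2//; apply: le_lt_trans finO; rewrite -int1O.
  apply: ge0_le_integral => //.
  - by move=> x _; apply: integral_ge0.
  - exact: measurable_fun_fubini_tonelli_G.
  - by apply/measurable_EFinP; apply: measurable_funM.
  move=> y _; rewrite /fubini_G /g2 /=.
  under eq_integral do rewrite EFinM muleC.
  rewrite ge0_integralZl_EFin//.
  - rewrite muleC EFinM; apply: lee_wpmul2r; first by rewrite lee_fin.
    apply: le_trans (HC y).
    rewrite le_eqVlt; apply/orP; left; apply/eqP; apply: eq_integral => x _.
    by rewrite /k /lip_kernel /= enormB.
  - by move=> x _; rewrite lee_fin.
  - by apply/measurable_EFinP; exact: measurableT_comp mk (pair2_measurable y).
apply: (@le_lt_trans _ _ (\int[mu \x mu]_z (g1 z + g2 z))%E); last first.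
  by rewrite ge0_integralD// lte_add_pinfty.
rewrite /seminorm1 integral_mkcond; apply: ge0_le_integral => //.
- move=> z _; rewrite patchE; case: ifP => // _.
  by rewrite lee_fin mulr_ge0 ?invr_ge0 ?powR_ge0.
- apply/(measurable_restrictT _ (measurable_Q_Omega mO)).
  apply/measurable_EFinP; apply: measurable_funTS; apply: measurable_funM.
    apply: measurableT_comp => //; apply: measurable_funB.
      exact: (measurableT_comp mv measurable_fst).
    exact: (measurableT_comp mv measurable_snd).
  under eq_fun do rewrite -powRN.
  apply: (@measurableT_comp _ _ _ _ _ _
    (fun e : R => e `^ (- (d%:R + 2 * s)))) => //.
  exact: measurable_enormB.
- exact: emeasurable_funD.
move=> [x y] _; rewrite patchE; case: ifPn => [|_]; last by rewrite adde_ge0.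
rewrite inE /Q_Omega /= => xyO.
apply: (@le_trans _ _ (k (x, y))%:E).
  rewrite lee_fin ler_wpM2r ?invr_ge0 ?powR_ge0//.
  by rewrite le_min vL vM.
rewrite /g1 /g2 /= -EFinD lee_fin -mulrDr ler_peMr// !indicE.
have [Ox|Ox] := pselect (Omega x); first by rewrite mem_set// lerDl.
have [Oy|Oy] := pselect (Omega y); first by rewrite [y \in _]mem_set// lerDr.
by exfalso; apply: xyO.
Qed.

End finiteness.

(** * Lipschitz and affine functions *)

Section lipschitz_gluing.
Context {R : realType}.

(* Jump from [a] to the last point [c] of a piece containing [a]: that piece is not
   needed to cover what lies beyond [c]. *)
Lemma lipschitz_glue_itv (I : choiceType) (F : I -> set R) (f : R -> R) (L : R)
    (s : seq I) (a b : R) : a <= b ->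
  (forall i, i \in s -> closed (F i)) ->
  (forall i t u, i \in s -> F i t -> F i u -> `|f t - f u| <= L * `|t - u|) ->
  (forall t, a < t <= b -> exists2 i, i \in s & F i t) ->
  `|f b - f a| <= L * (b - a).
Proof.
move: {2}(size s) (leqnn (size s)) => n.
elim: n => [|n IH] in s a b *.
  rewrite leqn0 => /nilP -> ab _ _ cov.
  have : ~~ (a < b).
    by apply/negP => ab'; have [|i] := cov b; rewrite ?ab' ?lexx.
  rewrite -leNgt => ba; have -> : a = b by apply/eqP; rewrite eq_le ab.
  by rewrite !subrr normr0 mulr0.
move=> sn ab cF LF cov; move: ab; rewrite le_eqVlt => /predU1P[->|ab].
  by rewrite !subrr normr0 mulr0.
(* The cover is assumed only beyond a, because after a jump the remaining pieces cover only what
   lies beyond c. The point a is recovered as a limit, a finite union of closed sets being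
   closed. *)
have [i si Fia] : exists2 i, i \in s & F i a.
  have cU : closed (\bigcup_(i in [set` s]) F i).
    by apply: closed_bigcup => // i /=; exact: cF.
  suff : (\bigcup_(i in [set` s]) F i) a by case=> i; exists i.
  apply: cU => U /nbhs_ballP[e /= e0 aU].
  exists (Num.min b (a + e / 2)); split.
    have [|i si Fi] := cov (Num.min b (a + e / 2)); last by exists i.
    by rewrite lt_min ab ltrDl divr_gt0//= ge_min lexx.
  apply: aU; rewrite /ball/= ltr_norml; apply/andP; split.
    rewrite ltrBrDl ltrBlDr; apply: (@le_lt_trans _ _ (a + e / 2)).
      by rewrite ge_min lexx orbT.
    lra.
  rewrite ltrBlDr; apply: (@lt_le_trans _ _ (e + a)); first by lra.
  by rewrite lerD2l le_min; apply/andP; split; lra.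
have [c] : exists2 c, c \in `[a, b] `&` F i &
    forall t, t \in `[a, b] `&` F i -> t <= c.
  apply: (@compact_EVT_max _ _ id).
  - by exists a; split=> //=; rewrite in_itv/= lexx ltW.
  - by apply: compact_closedI; [exact: segment_compact|exact: cF].
  - by apply: continuous_subspaceT => x; exact: cvg_id.
rewrite inE/= in_itv/= => -[/andP[ac cb] Fc] cmax.
have fca := LF _ _ _ si Fc Fia.
rewrite (ger0_norm (_ : 0 <= c - a)) ?subr_ge0// in fca.
have fbc : `|f b - f c| <= L * (b - c).
  apply: (IH (rem i s)) => //.
  - by rewrite size_rem// -ltnS prednK//; case: (s) si.
  - by move=> j /mem_rem; exact: cF.
  - by move=> j t u /mem_rem; exact: LF.
  move=> t /andP[ct tb]; have [|j sj Fj] := cov t.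
    by rewrite tb (le_lt_trans ac).
  exists j => //; apply: rem_mem => //; apply/eqP => ji.
  have : t <= c.
    by apply: cmax; rewrite inE/= in_itv/= tb (le_trans ac (ltW ct)) -ji.
  by rewrite leNgt ct.
have -> : f b - f a = (f b - f c) + (f c - f a) by lra.
by apply: le_trans (ler_normD _ _) _; lra.
Qed.

(** Pulling the pieces back to the segment from y to x reduces to the line, with constant L |x - y|.
    A segment may enter and leave a piece several times; the pieces need not be convex. *)
Lemma lipschitz_glue (V : normedModType R) (I : choiceType) (F : I -> set V)
    (w : V -> R) (L : R) (s : seq I) :
  (forall i, i \in s -> closed (F i)) ->
  (forall i x y, i \in s -> F i x -> F i y -> `|w x - w y| <= L * `|x - y|) ->
  (forall x, exists2 i, i \in s & F i x) ->
  forall x y, `|w x - w y| <= L * `|x - y|.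
Proof.
move=> cF LF cov x y.
pose g (t : R) := y + t *: (x - y).
have cg : continuous g.
  move=> t; apply: cvgD; first exact: cvg_cst.
  by apply: cvgZr_tmp; exact: cvg_id.
have gB t u : `|g t - g u| = `|t - u| * `|x - y|.
  by rewrite /g opprD addrACA subrr add0r -scalerBl normrZ.
have := @lipschitz_glue_itv I (fun i => g @^-1` F i) (w \o g) (L * `|x - y|) s 0 1.
rewrite /g /= scale1r scale0r addr0 subr0 mulr1 [y + _]addrC subrK; apply => //.
- by move=> i si; apply: preimage_closed => [t _|]; [exact: cg|exact: cF].
- move=> i t u si Ft Fu; rewrite -mulrA [`|x - y| * _]mulrC -gB.
  exact: LF Ft Fu.
Qed.

End lipschitz_gluing.

Section affine.
Context {R : realType} {d : nat}.
Local Notation E := 'rV[R]_d.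
Implicit Types (v : E -> R) (x y : E).

Lemma dotpB (a x y : E) : dotp a (x - y) = dotp a x - dotp a y.
Proof.
by rewrite /dotp -sumrB; apply: eq_bigr => i _; rewrite !mxE mulrBr.
Qed.

Lemma dotpD (a x y : E) : dotp a (x + y) = dotp a x + dotp a y.
Proof.
by rewrite /dotp -big_split; apply: eq_bigr => i _; rewrite !mxE mulrDr.
Qed.

Lemma dotpZ (a x : E) t : dotp a (t *: x) = t * dotp a x.
Proof.
by rewrite /dotp mulr_sumr; apply: eq_bigr => i _; rewrite !mxE mulrCA.
Qed.

Lemma dotpC (x y : E) : dotp x y = dotp y x.
Proof. by apply: eq_bigr => i _; rewrite mulrC. Qed.

Lemma dotp_bound (a : E) : exists2 L : R, 0 <= L & forall x, `|dotp a x| <= L * `|x|.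
Proof.
exists (\sum_i `|a 0 i|); first by apply: sumr_ge0 => i _.
move=> x; apply: le_trans (ler_norm_sum _ _ _) _; rewrite mulr_suml.
apply: ler_sum => i _; rewrite normrM ler_wpM2l//; exact: coord_le_norm.
Qed.

Lemma P1_lipschitz (D : set E) v : P1 D v ->
  exists2 L : R, 0 <= L & forall x y, D x -> D y -> `|v x - v y| <= L * `|x - y|.
Proof.
move=> [a [b vE]]; have [L L0 HL] := dotp_bound a; exists L => // x y Dx Dy.
by rewrite !vE// opprD addrACA subrr addr0 -dotpB.
Qed.

Lemma P1_continuous v : P1 setT v -> continuous v.
Proof.
move=> /P1_lipschitz[L L0 HL] x U /nbhs_ballP[e /= e0 xU].
apply/nbhs_ballP; exists (e / (L + 1)) => /=; first by rewrite divr_gt0// ltr_pwDr.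
move=> y; rewrite mx_norm_ball /ball_ /= ltr_pdivlMr ?ltr_pwDr// => xy.
by apply: xU; apply: le_lt_trans (HL x y I I) _; nra.
Qed.

Lemma measurable_P1 (D : set E) v : measurable D -> P1 D v -> measurable_fun D v.
Proof.
move=> mD [a [b vE]].
apply: (@eq_measurable_fun _ _ _ _ _ (fun x => dotp a x + b)).
  by move=> x; rewrite inE => /vE.
apply: measurable_funTS; apply: measurable_funD => //.
apply: measurable_sum => i; apply: measurable_funM => //.
exact: measurable_coord_rV.
Qed.

Lemma P1B (D : set E) v1 v2 : P1 D v1 -> P1 D v2 -> P1 D (v1 \- v2).
Proof.
move=> [a1 [b1 E1]] [a2 [b2 E2]]; exists (a1 - a2), (b1 - b2) => x Dx.
by rewrite /= E1// E2// ![dotp _ x]dotpC dotpB; lra.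
Qed.

(** On the line through x and y, v is affine and vanishes at x and at a nearby point of U, hence
    also at y. *)
Lemma P1_eq0 v x (U : set E) : P1 setT v -> nbhs x U ->
  (forall y, U y -> v y = 0) -> forall y, v y = 0.
Proof.
move=> [a [b vE]] xU v0 y.
have [t t0 Ut] : exists2 t : R, 0 < t & U (x + t *: (y - x)).
  have := xU => /nbhs_cubeP[r r0 rU].
  (* Adding 1 keeps the quotient meaningful when y = x. *)
  exists (r / (`|y - x| + 1)); first by rewrite divr_gt0// ltr_pwDr.
  apply: rU => i; rewrite !mxE addrAC subrr add0r normrM gtr0_norm; last first.
    by rewrite divr_gt0// ltr_pwDr.
  rewrite mulrAC ler_pdivrMr ?ltr_pwDr// ler_wpM2l// ?(ltW r0)//.
  by have := coord_le_norm (y - x) i; rewrite !mxE; lra.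
have := v0 _ Ut; have := v0 _ (nbhs_singleton xU); rewrite !vE//.
rewrite dotpD dotpZ dotpB => e1 e2.
have : t * (dotp a y + b) = 0 by nra.
by move/eqP; rewrite mulf_eq0 gt_eqF//= => /eqP.
Qed.

End affine.

(** * Simplices and finite element functions *)

Section elements.
Context {R : realType} {d : nat}.
Local Notation E := 'rV[R]_d.
Implicit Types (T : 'M[R]_(d.+1, d)) (M : seq 'M[R]_(d.+1, d)) (v : E -> R).

Let hom T : 'M[R]_(d.+1, d + 1) := row_mx T (const_mx 1).

(** Solves w T = x with weights of sum 1 as one linear system in homogeneous coordinates. The matrix
    is square only up to [d + 1 = d.+1], hence the pseudo-inverse; it is a two-sided inverse when
    [T] is affinely independent. *)
Definition barycentric T (x : E) : 'rV[R]_d.+1 :=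
  row_mx x (const_mx 1 : 'rV[R]_1) *m pinvmx (hom T).

Let mul_hom T (w : 'rV[R]_d.+1) :
  w *m hom T = row_mx (w *m T) (const_mx (\sum_i w 0 i)).
Proof.
rewrite mul_mx_row; congr row_mx; apply/rowP => j; rewrite !mxE.
by apply: eq_bigr => i _; rewrite mxE mulr1.
Qed.

Lemma barycentricK T (w : 'rV[R]_d.+1) : affinely_independent T ->
  \sum_i w 0 i = 1 -> barycentric T (w *m T) = w.
Proof.
by move=> fT w1; rewrite /barycentric -w1 -mul_hom mulmxKp.
Qed.

Lemma barycentricP T x : affinely_independent T ->
  barycentric T x *m T = x /\ \sum_i barycentric T x 0 i = 1.
Proof.
move=> fT; have uT : row_full (hom T).
  by rewrite /row_full (eqP fT) addn1.
have := mul_hom T (barycentric T x).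
rewrite -mulmxA mulVpmx// mulmx1 => /eq_row_mx[<- /rowP/(_ 0)].
by rewrite !mxE.
Qed.

(** Weights are unique by affine independence, so the convex hull becomes an intersection of d + 1
    half-spaces, from which closedness and interior points are read off. *)
Lemma elementE T x : affinely_independent T ->
  element T x <-> forall i, 0 <= barycentric T x 0 i.
Proof.
move=> fT; split=> [[w [w0 _ w1 ->]] i|b0]; first by rewrite barycentricK.
have [b1 b2] := barycentricP x fT; exists (barycentric T x); split=> //.
by move=> i; rewrite inE.
Qed.

Lemma barycentric_P1 T i : P1 setT (fun x => barycentric T x 0 i).
Proof.
exists (\row_j pinvmx (hom T) (lshift 1 j) i), (pinvmx (hom T) (rshift d 0) i).
move=> x _; rewrite mxE big_split_ord/= big_ord1 row_mxEr mxE mul1r; congr (_ + _).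
by apply: eq_bigr => j _; rewrite row_mxEl mxE mulrC.
Qed.

Lemma element_closed T : affinely_independent T -> closed (element T).
Proof.
move=> fT; have -> : element T =
    \bigcap_(i in setT) ((fun x => barycentric T x 0 i) @^-1` [set r | 0 <= r]).
  apply/seteqP; split=> x; first by move=> /(elementE x fT) H i _; exact: H.
  by move=> H; apply/(elementE x fT) => i; exact: H.
apply: closed_bigI => i _; apply: preimage_closed => [x _|]; last exact: closed_ge.
exact/P1_continuous/barycentric_P1.
Qed.

(* Moving from the vertex towards the barycentre makes every coordinate positive. *)
Lemma element_interior_near_vertex T k (U : set E) : affinely_independent T ->
  nbhs (row k T) U -> exists2 x, U x & nbhs x (element T).
Proof.
move=> fT /nbhs_cubeP[r r0 rU].
pose c : 'rV[R]_d.+1 := const_mx (d.+1%:R^-1).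
have c1 : \sum_i c 0 i = 1.
  under eq_bigr do rewrite mxE.
  by rewrite sumr_const card_ord -[LHS]mulr_natl divff// pnatr_eq0.
(* The bound 1 keeps the weights of [w] nonnegative, the other bound keeps the moved point in U. *)
pose t := Num.min 1 (r / (`|c *m T - row k T| + 1)).
have N0 : 0 < `|c *m T - row k T| + 1 by rewrite ltr_pwDr.
have t0 : 0 < t by rewrite lt_min ltr01 divr_gt0.
have t1 : t <= 1 by rewrite ge_min lexx.
have tr : t * (`|c *m T - row k T| + 1) <= r.
  by rewrite -ler_pdivlMr// ge_min lexx orbT.
pose w : 'rV[R]_d.+1 := (1 - t) *: delta_mx 0 k + t *: c.
exists (w *m T).
  apply: rU => i.
  have -> : w *m T = row k T + t *: (c *m T - row k T).
    rewrite mulmxDl -!scalemxAl -rowE scalerBr scalerBl scale1r.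
    by rewrite addrA addrAC.
  rewrite mxE addrAC subrr add0r mxE normrM gtr0_norm//.
  by have := coord_le_norm (c *m T - row k T) i; nra.
have w1 : \sum_i w 0 i = 1.
  under eq_bigr do rewrite mxE [X in X + _]mxE [X in _ + X]mxE.
  rewrite big_split -!mulr_sumr c1 (bigD1 k)//= mxE !eqxx /= big1 ?addr0; first by lra.
  by move=> i /negbTE ik; rewrite mxE ik andbF.
apply: (@filterS _ (nbhs (w *m T)) _
    [set x | forall i, 0 < barycentric T x 0 i]).
  by move=> x Hx; apply/(elementE x fT) => i; apply/ltW/Hx.
apply: (@filter_forall _ _ (fun i x => 0 < barycentric T x 0 i)
  (nbhs (w *m T)) (nbhs_filter _)) => i.
have bpos : nbhs (barycentric T (w *m T) 0 i) [set e | 0 < e].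
  apply: open_nbhs_nbhs; split; first exact: open_gt.
  rewrite /= barycentricK// /w !mxE; apply: ltr_wpDl.
    by rewrite mulr_ge0 ?subr_ge0.
  by rewrite mulr_gt0// invr_gt0.
exact: (P1_continuous (barycentric_P1 T i)) bpos.
Qed.

End elements.

Section discrete_functions.
Context {R : realType} {d : nat} (Omega Lambda : set 'rV[R]_d)
  (M : seq 'M[R]_(d.+1, d)).
Local Notation E := 'rV[R]_d.
Implicit Types v w : E -> R.

Hypothesis mesh : conforming_mesh Lambda M.

Let indep T : T \in M -> affinely_independent T.
Proof. by case: mesh => + _ _ => /[apply]. Qed.

Lemma measurable_mesh : measurable Lambda.
Proof.
case: mesh => _ _ <-; apply: fin_bigcup_measurable => // T TM.
by apply: closed_measurable_rV; apply: element_closed; exact: indep.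
Qed.

Lemma measurable_Vh v : Vh Lambda M v -> measurable_fun setT v.
Proof.
move=> [_ vP1 v0]; rewrite -(setUv Lambda).
apply/(measurable_funU v measurable_mesh (measurableC measurable_mesh)).
split; last first.
  by apply: (@eq_measurable_fun _ _ _ _ _ (cst (0 : R))) => // x; rewrite inE => /v0 ->.
have [_ _ <-] := mesh; rewrite /union_of bigcup_seq.
(* Sets up an induction on sublists of M, with the mesh properties still available for all of M. *)
have : {subset M <= M} by [].
elim: {1 3}M => [|T N IH] NM; first by rewrite big_nil; exact: measurable_fun_set0.
have TM : T \in M by apply: NM; rewrite mem_head.
have NM' : {subset N <= M} by move=> U UN; apply: NM; rewrite inE UN orbT.
have mT T' : T' \in M -> measurable (element T').
  by move=> T'M; apply: closed_measurable_rV; apply: element_closed; exact: indep.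
rewrite big_cons; apply/measurable_funU.
- exact: mT.
- by rewrite -bigcup_seq; apply: fin_bigcup_measurable => // T' /NM'/mT.
split; last exact: IH.
exact: measurable_P1 (mT _ TM) (vP1 _ TM).
Qed.

Lemma VhB v w : Vh Lambda M v -> Vh Lambda M w -> Vh Lambda M (v \- w).
Proof.
move=> [cv Pv v0] [cw Pw w0]; split.
- by move=> x; apply: cvgB; [exact: cv|exact: cw].
- by move=> T TM; apply: P1B; [exact: Pv|exact: Pw].
- by move=> x Lx; rewrite /= v0// w0// subrr.
Qed.

(** The closed complement of Omega, where v is 0, joins the elements as one more piece ([None]), so
    that the whole space is covered. Vanishing outside Omega also excludes a jump of the zero
    extension across the boundary of Lambda. *)
Lemma Vh_lipschitz v : open Omega -> Vh Lambda M v ->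
  Omega `<=` Lambda -> (forall x, ~ Omega x -> v x = 0) ->
  exists2 L : R, 0 <= L & forall x y, `|v x - v y| <= L * `|x - y|.
Proof.
move=> oO [_ vP1 _] OL v0.
have [L L0 HL] : exists2 L : R, 0 <= L & forall T x y, T \in M ->
    element T x -> element T y -> `|v x - v y| <= L * `|x - y|.
  have : {subset M <= M} by [].
  elim: {1 3}M => [|T N IH] NM; first by exists 0.
  have [|L L0 HL] := IH; first by move=> U UN; apply: NM; rewrite inE UN orbT.
  have [L' L'0 HL'] := P1_lipschitz (vP1 _ (NM _ (mem_head _ _))).
  exists (L + L'); first exact: addr_ge0.
  move=> T' x y; rewrite inE => /predU1P[->|T'N] Tx Ty.
    apply: le_trans (HL' _ _ Tx Ty) _.
    by rewrite ler_wpM2r// lerDr.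
  apply: le_trans (HL _ _ _ T'N Tx Ty) _.
  by rewrite ler_wpM2r// lerDl.
exists L => //.
apply: (@lipschitz_glue R E (option 'M[R]_(d.+1, d))
  (fun i => if i is Some T then element T else ~` Omega) v L
  (None :: map Some M)).
- move=> [T|_]; last exact: open_closedC.
  rewrite inE/= => /mapP[T' T'M [->]]; by apply: element_closed; exact: indep.
- move=> [T|] x y.
    rewrite inE/= => /mapP[T' T'M [->]]; exact: HL.
  by move=> _ /v0 -> /v0 ->; rewrite subrr normr0 mulr_ge0.
move=> x; have [Ox|Ox] := pselect (Omega x); last first.
  by exists None => //; rewrite mem_head.
have [_ _ LE] := mesh; have := OL _ Ox; rewrite -LE => -[T TM Tx].
by exists (Some T) => //; rewrite inE/= map_f.
Qed.

End discrete_functions.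

(** * The exterior interpolant of zero *)

Section lipschitz_domain.
Context {R : realType} {d : nat} (Omega : set 'rV[R]_d).
Local Notation E := 'rV[R]_d.

(* Below a point of the boundary, in the direction of the graph, lies the interior of
   the complement. *)
Lemma setC_interior_dense (x0 : E) (U : set E) : open Omega ->
  lipschitz_boundary Omega -> ~ Omega x0 -> nbhs x0 U ->
  exists2 x1, U x1 & nbhs x1 (~` Omega).
Proof.
move=> oO lipO Ox0 x0U; have [cx0|cx0] := pselect (closure Omega x0); last first.
  exists x0; first exact: nbhs_singleton.
  apply: (@filterS _ (nbhs x0) _ (~` closure Omega)).
    by apply: subsetC; exact: subset_closure.
  by apply: open_nbhs_nbhs; split=> //; apply: closed_openC; exact: closed_closure.
have [|r [e [gamma [r0 e1 [L Lgamma] Oe]]]] := lipO x0.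
  by split=> // /interior_subset.
have ee : dotp e e = 1.
  by rewrite -[LHS](@sqr_sqrtr _ (dotp e e)) ?dotp_ge0// -/(enorm e) e1 expr1n.
pose p (y : E) := y - dotp y e *: e.
have pe y : dotp (p y) e = 0.
  by rewrite dotpC dotpB dotpZ ee mulr1 dotpC subrr.
have [Le Le0 HLe] := dotp_bound e.
have pB y z : `|p y - p z| <= (1 + Le * `|e|) * `|y - z|.
  have -> : p y - p z = (y - z) - dotp (y - z) e *: e.
    by rewrite /p [dotp (_ - _) _]dotpC dotpB scalerBl ![dotp e _]dotpC !opprB;
      rewrite [LHS]addrACA [RHS]addrACA; congr (_ + _); rewrite addrC.
  apply: le_trans (ler_normB _ _) _; rewrite normrZ mulrDl mul1r lerD2l.
  rewrite mulrAC ler_wpM2r//.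
  by rewrite dotpC.
(* Signed height above the graph: near x0, Omega is where [h] is positive. Moving by - t e leaves
   [p] unchanged and lowers [h] by exactly t; as [h] has Lipschitz constant C, it stays nonpositive
   within t / (C + 1) of the new point. *)
pose h (y : E) := dotp y e - gamma (p y).
pose C := Le + `|L| * (1 + Le * `|e|).
have C0 : 0 <= C by rewrite addr_ge0// mulr_ge0// addr_ge0// mulr_ge0.
have hB y z : `|h y - h z| <= C * `|y - z|.
  have -> : h y - h z = dotp e (y - z) - (gamma (p y) - gamma (p z)).
    by rewrite dotpB ![dotp e _]dotpC /h; lra.
  apply: le_trans (ler_normB _ _) _; rewrite mulrDl lerD//.
  apply: (@le_trans _ _ (L * `|p y - p z|)).
    by apply: (Lgamma (p y, p z)); split; exact: pe.
  apply: (@le_trans _ _ (`|L| * `|p y - p z|)).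
    by rewrite ler_wpM2r// ler_norm.
  by rewrite -mulrA ler_wpM2l.
have [r' r'0 rU] := (nbhs_cubeP _ _).1 x0U.
have d0 : 0 <= d%:R :> R by rewrite ler0n.
(* The first bound keeps x1 in U. The second puts the cube of radius 2t around x0 in the Euclidean
   ball of radius r; the factor 2 pays for the shift and for the cube around x1. *)
pose t := Num.min r' (r / (2 * (d%:R + 1))).
have t0 : 0 < t by rewrite lt_min r'0 divr_gt0// mulr_gt0// ltr_wpDl.
have tr' : t <= r' by rewrite ge_min lexx.
have tr : t * (2 * (d%:R + 1)) <= r.
  by rewrite -ler_pdivlMr ?ge_min ?lexx ?orbT// mulr_gt0// ltr_wpDl.
have ei i : `|e 0 i| <= 1 by rewrite -e1 coord_le_enorm.
pose x1 := x0 - t *: e.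
exists x1.
  apply: rU => i; apply: le_trans tr'; rewrite !mxE addrAC subrr add0r normrN.
  by rewrite normrM gtr0_norm// ler_piMr// ltW.
have hx0 : h x0 <= 0.
  rewrite subr_le0 leNgt; apply/negP => hx; apply/Ox0/Oe => //.
  by rewrite /eball/= subrr /enorm /dotp big1 ?sqrtr0 ?ltW// => i _; rewrite mxE mul0r.
have hx1 : h x1 <= - t.
  have p1 : p x1 = p x0.
    rewrite /p /x1 [dotp (_ - _) _]dotpC dotpB dotpZ ee mulr1 scalerBl.
    by rewrite [dotp e _]dotpC opprB addrA subrK.
  rewrite /h p1 /x1 [dotp (_ - _) _]dotpC dotpB dotpZ ee [dotp e _]dotpC.
  by move: hx0; rewrite /h; lra.
have C1 : 0 < C + 1 by rewrite ltr_wpDl.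
have rho0 : 0 < t / (C + 1) by rewrite divr_gt0.
have rhot : t / (C + 1) <= t by rewrite ler_pdivrMr//; nra.
apply/nbhs_cubeP; exists (t / (C + 1)) => // y yx1.
have yx : cube x0 (2 * t) y.
  move=> i; have := yx1 i; rewrite /x1 !mxE => yi.
  have -> : y 0 i - x0 0 i = (y 0 i - (x0 0 i - t * e 0 i)) - t * e 0 i by lra.
  apply: le_trans (ler_normB _ _) _; rewrite normrM (gtr0_norm t0).
  by have := ei i; nra.
rewrite /= Oe; last first.
  rewrite /eball /=; apply: le_trans (enorm_cube _ yx) _; first by rewrite mulr_ge0// ltW.
  nra.
apply/negP; rewrite -leNgt -subr_le0 -/(h y).
have yx1' : `|y - x1| <= t / (C + 1).
  rewrite [leLHS]/Num.norm/= mx_normrE; apply/bigmax_leP; split; first exact: ltW.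
  by move=> [i j] _ /=; rewrite ord1; have := yx1 j; rewrite !mxE.
have := hB y x1.
have : C * `|y - x1| <= t.
  apply: (@le_trans _ _ (C * (t / (C + 1)))); first by rewrite ler_wpM2l.
  rewrite mulrCA ger_pMr// ler_pdivrMr//; lra.
have := ler_norm (h y - h x1); lra.
Qed.

End lipschitz_domain.

Section clement_zero.
Context {R : realType} {d : nat} (Omega Lambda : set 'rV[R]_d)
  (M : seq 'M[R]_(d.+1, d)).
Local Notation E := 'rV[R]_d.
Local Notation mu := (@lebesgue_rV R d).

(** Tested with itself, any projection p of 0 has zero integral of p^2 over D. The open set of
    interior points of D with p nonzero is then negligible, hence empty; so p vanishes near x, and
    everywhere since it is affine. *)
Lemma L2_proj_P1_0 (D : set E) (x y : E) : measurable D -> nbhs x D ->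
  L2_proj_P1 D (fun=> 0) y = 0.
Proof.
move=> mD xD; rewrite /L2_proj_P1.
have [|p1 orth] := @xgetPex _ (fun=> 0 : R) [set p | P1 setT p /\ forall q, P1 setT q ->
    (\int[mu]_(x in D) ((0 - p x) * q x)%:E = 0)%E].
  exists (fun=> 0); split.
    by exists 0, 0 => z _; rewrite addr0 /dotp big1// => i _; rewrite mxE mul0r.
  by move=> q _; apply: integral0_eq => z _; rewrite subrr mul0r.
set p := xget _ _ in p1 orth *.
have mp : measurable_fun D (fun z => (p z ^+ 2)%:E).
  apply/measurable_EFinP; apply: measurable_funX.
  by apply: measurable_funTS; exact: measurable_P1 p1.
have : (\int[mu]_(z in D) `|(p z ^+ 2)%:E| = 0)%E.
  rewrite -[LHS]oppeK -integral_ge0N; last by move=> z _; exact: abse_ge0.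
  rewrite -[RHS]oppe0; congr (- _)%E; rewrite -(orth _ p1).
  apply: eq_integral => z _; rewrite sub0r mulNr -expr2.
  by rewrite abse_EFin ger0_norm ?sqr_ge0// EFinN.
move/(ae_eq_integral_abs mu mD mp) => p0.
have Dneg : mu.-negligible (D° `&` [set z | p z != 0]).
  apply: negligibleS p0 => z [Dz pz] /= /(_ (interior_subset Dz)) [] /eqP.
  by rewrite sqrf_eq0; apply/negP.
have o : open (D° `&` [set z | p z != 0]).
  apply: openI; first exact: open_interior.
  rewrite (_ : [set z | _] = p @^-1` [set r | r != 0]) //.
  apply: open_comp => [z _|]; first exact: P1_continuous.
  exact: open_neq.
apply: (P1_eq0 p1 (nbhs_interior xD)) => z Dz.
apply/eqP; apply: contrapT => pz; apply: (open_not_negligible o) Dneg.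
by exists z; split=> //; exact/negP.
Qed.

Hypotheses (Omega_lip : bounded_lipschitz_domain Omega)
  (Omega_Lambda : closure Omega `<=` interior Lambda)
  (mesh : conforming_mesh Lambda M).

(** A vertex in the closure of Omega is interior to Lambda, and the Lipschitz graph supplies the
    points. Any other vertex may lie on the boundary of Lambda, and the points come from the
    interior of a simplex having it as a vertex. *)
Lemma vertex_exterior_interior xi (U : set E) : xi \in vertices M -> ~ Omega xi ->
  nbhs xi U -> exists2 x, U x & nbhs x (Lambda `&` ~` Omega).
Proof.
move=> xiM Oxi xiU; have [_ oO _ _ lipO] := Omega_lip.
have [indep _ LE] := mesh.
have [cxi|cxi] := pselect (closure Omega xi).
  have [|x [Ux Lx] xO] := setC_interior_dense oO lipO Oxi (U := U `&` Lambda°).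
    apply: filterI => //; apply: open_nbhs_nbhs; split; first exact: open_interior.
    exact: Omega_Lambda.
  exists x => //; apply: filterI => //.
move: xiM; rewrite /vertices mem_undup => /allpairsP[[T k]] /= [TM _ xiE].
have [|x [Ux cx] xT] := @element_interior_near_vertex _ _ T k (U `&` ~` closure Omega)
    (indep T TM).
  rewrite -xiE; apply: filterI => //; apply: open_nbhs_nbhs; split=> //.
  by apply: closed_openC; exact: closed_closure.
exists x => //; apply: filterI.
  by apply: filterS xT; rewrite -LE => z Tz; exists T.
apply: (@filterS _ (nbhs x) _ (~` closure Omega)).
  by apply: subsetC; exact: subset_closure.
by apply: open_nbhs_nbhs; split=> //; apply: closed_openC; exact: closed_closure.
Qed.

(* If the nodal basis function at a vertex exists, its patch meets the exterior of
   Omega in a set with interior points, and the projection is unique there; otherwise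
   [nodal_basis] takes its default value 0. *)
Lemma clement_ext0 x : clement_ext Omega Lambda M (fun=> 0) x = 0.
Proof.
rewrite /clement_ext big_seq_cond big1// => xi /andP[xiM xiO].
have [_ oO _ _ _] := Omega_lip.
have {xiO}Oxi : ~ Omega xi by move=> Oxi; move/negP: xiO; apply; rewrite inE.
rewrite /Defs.patch; set phi := nodal_basis Lambda M xi.
have [[phiV phi1]|] := pselect ([set phi | Vh Lambda M phi /\
    forall xj, xj \in vertices M -> phi xj = (xj == xi)%:R] phi); last first.
  move=> nphi; have -> : phi = fun=> 0; last by rewrite mulr0.
  by rewrite /phi /nodal_basis xgetPN// => z Pz; apply: nphi; apply: xgetPex; exists z.
have phixi : phi xi != 0 by rewrite phi1// eqxx oner_neq0.
have Lxi : Lambda xi.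
  apply: contrapT => Lxi; move: phixi; have [_ _ ->//] := phiV.
  by rewrite eqxx.
(* Continuity of [phi] is relative to Lambda, so it is nonzero only at nearby points of Lambda. *)
have phi_near : nbhs xi [set y | Lambda y -> phi y != 0].
  have [/subspace_continuousP cphi _ _] := phiV.
  apply: (cphi _ Lxi [set r | r != 0]).
  by apply: open_nbhs_nbhs; split=> //; exact: open_neq.
have [y Uy yD] := vertex_exterior_interior xiM Oxi (nbhs_interior phi_near).
rewrite (@L2_proj_P1_0 _ y) ?mul0r//.
  apply: measurableI.
    by apply: closed_measurable_rV; exact: closed_closure.
  by apply: measurableC; exact: open_measurable_rV.
apply: (@filterS _ (nbhs y) _ ([set y | Lambda y -> phi y != 0] `&`
    (Lambda `&` ~` Omega))).
  by move=> z [Hz [Lz Oz]]; split=> //; apply: subset_closure; exact: Hz.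
by apply: filterI.
Qed.

End clement_zero.

(** * Quasi-optimality *)

Section energy.
Context {R : realType} {d : nat} (s : R) (Omega : set 'rV[R]_d).
Local Notation E := 'rV[R]_d.
Local Notation mu := (@lebesgue_rV R d).
Local Notation mu2 := (mu \x mu)%E.
Local Notation Q := (Q_Omega Omega).
Implicit Types (u v w : E -> R) (z : E * E).

(** Signed integrand of the seminorm; the integrands of [a_form] and of the error are values of [Gs]
    times it. *)
Definition sdiff v z : R :=
  (v z.1 - v z.2) / enorm (z.1 - z.2) `^ (d%:R + 2 * s).

Lemma normr_sdiff v z :
  `|v z.1 - v z.2| / enorm (z.1 - z.2) `^ (d%:R + 2 * s) = `|sdiff v z|.
Proof. by rewrite /sdiff normrM normfV (ger0_norm (powR_ge0 _ _)). Qed.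

Lemma seminorm1E v :
  seminorm1 (2 * s) Q v = (\int[mu2]_(z in Q) `|(sdiff v z)%:E|)%E.
Proof. by apply: eq_integral => z _; rewrite normr_sdiff. Qed.

(** A positive exponent p lets e e^(p - 1) = e^p hold on the diagonal too, where e = 0. *)
Lemma dquot_sdiff v z : 0 < d%:R + 2 * s ->
  dquot v z / enorm (z.1 - z.2) `^ (d%:R - 1 + 2 * s) = sdiff v z.
Proof.
move=> p0; rewrite /dquot /sdiff -mulrA -invfM; congr (_ / _).
rewrite -(mulr_powRB1 (enorm_ge0 _) p0) [RHS]mulrC mulrC.
by congr (_ * _ `^ _); lra.
Qed.

Lemma Gs_tilde_sdiff u v z : 0 < d%:R + 2 * s ->
  Gs_tilde d s (dquot u z) * ((u z.1 - u z.2) * (v z.1 - v z.2) /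
    enorm (z.1 - z.2) `^ (d%:R + 1 + 2 * s)) = Gs d s (dquot u z) * sdiff v z.
Proof.
move=> p0; rewrite Gs_tildeE /sdiff {2}/dquot.
have p1 : 0 < d%:R + 1 + 2 * s by lra.
rewrite -(mulr_powRB1 (enorm_ge0 _) p1).
have -> : d%:R + 1 + 2 * s - 1 = d%:R + 2 * s by lra.
by rewrite [_ / _ * _]mulrC -[RHS]mulrA mulf_div.
Qed.

Lemma measurable_dquot v : measurable_fun setT v -> measurable_fun setT (dquot v).
Proof.
move=> mv; apply: measurable_funM.
  apply: measurable_funB; first exact: (measurableT_comp mv measurable_fst).
  exact: (measurableT_comp mv measurable_snd).
under eq_fun do rewrite -powR_inv1 ?enorm_ge0//.
apply: (@measurableT_comp _ _ _ _ _ _ (fun e : R => e `^ (-1))) => //.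
exact: measurable_enormB.
Qed.

Lemma measurable_sdiff v : measurable_fun setT v -> measurable_fun setT (sdiff v).
Proof.
move=> mv; apply: measurable_funM.
  apply: measurable_funB; first exact: (measurableT_comp mv measurable_fst).
  exact: (measurableT_comp mv measurable_snd).
under eq_fun do rewrite -powRN.
apply: (@measurableT_comp _ _ _ _ _ _ (fun e : R => e `^ (- (d%:R + 2 * s)))) => //.
exact: measurable_enormB.
Qed.

Hypotheses (d_gt0 : (0 < d)%N) (s_gt0 : 0 < s) (mO : measurable Omega).

Let p_gt0 : 0 < d%:R + 2 * s.
Proof. by rewrite ltr_wpDl// mulr_gt0. Qed.

Let mQ : measurable Q := measurable_Q_Omega mO.

(** Since [Gs] is bounded by K, only the seminorm of v matters; u may be any measurable function. *)
Lemma integrable_Gs_sdiff u v : measurable_fun setT u -> measurable_fun setT v ->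
  (seminorm1 (2 * s) Q v < +oo)%E ->
  mu2.-integrable Q (fun z => (Gs d s (dquot u z) * sdiff v z)%:E).
Proof.
move=> mu_ mv; rewrite seminorm1E => fv.
have mG : measurable_fun setT (Gs d s \o dquot u).
  by apply: measurableT_comp; [exact: measurable_Gs|exact: measurable_dquot].
have iv : mu2.-integrable Q (EFin \o sdiff v).
  apply/integrableP; split=> //; apply/measurable_EFinP.
  by apply: measurable_funTS; exact: measurable_sdiff.
apply: le_integrable (integrableZl mQ (K_ds d s) iv) => //.
  apply/measurable_EFinP; apply: measurable_funTS.
  by apply: measurable_funM => //; exact: measurable_sdiff.
move=> z _; rewrite /comp -EFinM !abse_EFin lee_fin !normrM ler_wpM2r//.
by rewrite (le_trans (Gs_le_K d_gt0 s_gt0 _))// ler_norm.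
Qed.

Lemma a_formE u v : a_form s Omega u u v =
  (\int[mu2]_(z in Q) (Gs d s (dquot u z) * sdiff v z)%:E)%E.
Proof. by apply: eq_integral => z _; rewrite Gs_tilde_sdiff. Qed.

(* The error is tested with [u - vh] instead of [u - uh]: the difference [vh - uh]
   is an admissible test function for both equations. *)
Lemma energy_error_le (u uh vh : E -> R) : measurable_fun setT u -> measurable_fun setT uh ->
  measurable_fun setT vh ->
  (seminorm1 (2 * s) Q (u \- vh)%R < +oo)%E ->
  (seminorm1 (2 * s) Q (vh \- uh)%R < +oo)%E ->
  a_form s Omega u u (vh \- uh)%R = 0%E -> a_form s Omega uh uh (vh \- uh)%R = 0%E ->
  (\int[mu2]_(z in Q) ((Gs d s (dquot u z) - Gs d s (dquot uh z)) *
       (dquot (u \- uh)%R z / enorm (z.1 - z.2) `^ (d%:R - 1 + 2 * s)))%:E <=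
   (2 * K_ds d s)%:E * seminorm1 (2 * s) Q (u \- vh)%R)%E.
Proof.
move=> mu_ muh mvh fuv fvu; rewrite !a_formE => a1 a2.
have muv : measurable_fun setT (u \- vh) by exact: measurable_funB.
have mvu : measurable_fun setT (vh \- uh) by exact: measurable_funB.
have i1 := integrable_Gs_sdiff mu_ muv fuv.
have i2 := integrable_Gs_sdiff muh muv fuv.
have j1 := integrable_Gs_sdiff mu_ mvu fvu.
have j2 := integrable_Gs_sdiff muh mvu fvu.
rewrite (_ : (\int[mu2]_(z in Q) _ = \int[mu2]_(z in Q) (
    ((Gs d s (dquot u z) * sdiff (u \- vh)%R z)%:E -
     (Gs d s (dquot uh z) * sdiff (u \- vh)%R z)%:E) +
    ((Gs d s (dquot u z) * sdiff (vh \- uh)%R z)%:E -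
     (Gs d s (dquot uh z) * sdiff (vh \- uh)%R z)%:E)))%E); last first.
  apply: eq_integral => z _; rewrite dquot_sdiff// -!EFinB -EFinD; congr EFin.
  rewrite -!mulrBl -mulrDr; congr (_ * _).
  by rewrite /sdiff -mulrDl /=; congr (_ / _); lra.
rewrite integralD//; [|exact: integrableB|exact: integrableB].
rewrite [X in (_ + X)%E]integralB// a1 a2 sube0 adde0.
apply: le_trans (lee_abs _) _.
apply: le_trans (le_abse_integral _ mQ _) _.
  by case/integrableP : (integrableB mQ i1 i2).
rewrite seminorm1E -ge0_integralZl_EFin//; last 2 first.
- by apply/measurableT_comp => //; apply/measurable_EFinP; apply: measurable_funTS;
    exact: measurable_sdiff.
- by rewrite mulr_ge0// K_ge0.
apply: ge0_le_integral => //.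
- by apply: measurableT_comp => //; case/integrableP : (integrableB mQ i1 i2).
- apply: measurable_funeM; apply: measurableT_comp => //; apply/measurable_EFinP.
  by apply: measurable_funTS; exact: measurable_sdiff.
move=> z _; rewrite -EFinB !abse_EFin lee_fin -mulrBl normrM ler_wpM2r//.
apply: le_trans (ler_normB _ _) _; rewrite mulr_natl mulr2n.
by rewrite lerD// Gs_le_K.
Qed.

End energy.

(** * Discrete test functions in the continuous space, and the error bound *)

Lemma C_ds_ge0 (R : realType) d (s : R) : s < 1 / 2 -> 0 <= C_ds d s.
Proof.
move=> s1; rewrite mulr_ge0//; first by lra.
by rewrite invr_ge0; apply: fine_ge0.
Qed.

Lemma Vh_zero_V_space (R : realType) (d : nat) (s : R) (Omega Lambda : set 'rV[R]_d)
    (M : seq 'M[R]_(d.+1, d)) (w : 'rV[R]_d -> R) :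
  (0 < d)%N -> 0 < s < 1 / 2 -> bounded_set Omega -> open Omega ->
  Omega `<=` Lambda -> conforming_mesh Lambda M -> Vh Lambda M w ->
  (forall x, ~ Omega x -> w x = 0) -> V_space s Omega (fun=> 0) w.
Proof.
move=> d0 s01 bO oO OL mesh Vw w0.
have mO := open_measurable_rV oO.
have mw := measurable_Vh mesh Vw.
have [L L0 HL] := Vh_lipschitz mesh oO Vw OL w0.
have [M' M'0 HM] : exists2 M' : R, 0 <= M' & forall x, `|w x| <= M'.
  have [r r0 Or] := bounded_set_cube bO.
  (* A point outside the cube around Omega, as d > 0 gives it a coordinate above r. There w = 0, so
     the Lipschitz bound towards z also bounds w. *)
  pose z : 'rV[R]_d := const_mx (r + 1).
  have Oz : ~ Omega z.
    move=> /Or /(_ (Ordinal d0)); rewrite !mxE subr0.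
    by have := ler_norm (r + 1); lra.
  exists (L * (r + `|z|)); first by rewrite mulr_ge0// addr_ge0// ltW.
  move=> x; have [Ox|Ox] := pselect (Omega x); last first.
    by rewrite w0// normr0 mulr_ge0// addr_ge0// ltW.
  have := HL x z; rewrite (w0 z)// subr0 => /le_trans; apply.
  rewrite ler_wpM2l// (le_trans (ler_normB _ _))// lerD2r.
  rewrite [leLHS]/Num.norm/= mx_normrE; apply/bigmax_leP; split; first exact: ltW.
  by move=> [i j] _ /=; rewrite ord1; have := Or x Ox j; rewrite mxE subr0.
have fw : (seminorm1 (2 * s) (Q_Omega Omega) w < +oo)%E.
  apply: (@seminorm1_lip_fin _ _ _ _ _ L (M' + M')) => //.
  - exact: addr_ge0.
  - move=> x y; apply: le_trans (HL x y) _; rewrite ler_wpM2l//.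
    exact: norm_le_enorm.
  - by move=> x y; apply: le_trans (ler_normB _ _) _; rewrite lerD.
split => //; last first.
- by apply: aeW => x /w0.
split.
  apply: (@measurable_bounded_integrable) => //.
  - exact: bounded_lebesgue_fin.
  - exact: measurable_funTS.
  - exists M'; split; first exact: num_real.
    by move=> y My x _; apply: le_trans (HM x) (ltW My).
(* Omega x Omega lies in Q, so the Sobolev seminorm is already controlled. *)
apply: le_lt_trans fw; apply: ge0_subset_integral => //.
- exact: measurableX.
- exact: measurable_Q_Omega.
- apply/measurable_EFinP; under eq_fun do rewrite normr_sdiff.
  apply: measurable_funTS; apply: measurableT_comp => //.
  exact: measurable_sdiff.
- by move=> z _; rewrite lee_fin mulr_ge0 ?invr_ge0 ?powR_ge0.
- by move=> [x y] [Ox Oy] [].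
Qed.

Theorem theorem5p1 (R : realType) (d : nat) (s : R)
    (Omega Lambda : set 'rV[R]_d) (g : 'rV[R]_d -> R)
    (H : set R) (Th : R -> seq 'M[R]_(d.+1, d))
    (u : 'rV[R]_d -> R) (h : R) (uh : 'rV[R]_d -> R)
    (d_gt0 : (0 < d)%N) (s_range : 0 < s < 1 / 2)
    (Omega_lip : bounded_lipschitz_domain Omega)
    (g_bounded : g \in Lfun lebesgue_rV +oo%E)
    (g_compact : compact (ess_supp g))
    (Lambda_bounded : bounded_set Lambda)
    (g_Lambda : ess_supp g `<=` Lambda)
    (Omega_Lambda : closure Omega `<=` interior Lambda)
    (H_gt0 : forall h', H h' -> 0 < h')
    (Th_mesh : forall h', H h' ->
       [/\ conforming_mesh Lambda (Th h'), meshes_exactly Omega (Th h') &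
           mesh_size (Th h') = h'])
    (Th_regular : shape_regular H Th)
    (u_V : V_space s Omega g u)
    (u_sol : forall v, V_space s Omega (fun=> 0) v ->
       a_form s Omega u u v = 0%E)
    (h_H : H h)
    (uh_V : Vh_space Omega Lambda (Th h) g uh)
    (uh_sol : forall vh, Vh_space Omega Lambda (Th h) (fun=> 0) vh ->
       a_form s Omega uh uh vh = 0%E) :
  (e_s s Omega u uh <=
   ereal_inf [set sqrte ((2 * C_ds d s * K_ds d s)%:E *
                         seminorm1 (2 * s) (Q_Omega Omega) (u \- vh)%R)
             | vh in Vh_space Omega Lambda (Th h) g])%E.
Proof.
have [s0 s1] := andP s_range.
have [_ oO _ bO lipO] := Omega_lip.
have [mesh _ _] := Th_mesh h h_H.
have mO := open_measurable_rV oO.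
have OL : Omega `<=` Lambda.
  by move=> x Ox; apply: interior_subset; apply: Omega_Lambda; exact: subset_closure.
have [mu _ _ fu] := u_V; have [Vuh uhE] := uh_V.
have C0 := C_ds_ge0 d s1.
have K0 := K_ge0 d_gt0 s0.
apply: le_ereal_inf_tmp => _ [vh [Vvh vhE] <-].
have Vw := VhB Vvh Vuh.
have w0 x : ~ Omega x -> (vh \- uh) x = 0.
  move=> Ox; have [Lx|Lx] := pselect (Lambda x).
    by rewrite /= vhE// uhE// subrr.
  by have [_ _ ->] := Vw.
have wV := Vh_zero_V_space d_gt0 s_range bO oO OL mesh Vw w0.
have a1 := u_sol _ wV.
(* The exterior data prescribed for discrete test functions is the interpolant of 0, which is 0. *)
have a2 : a_form s Omega uh uh (vh \- uh) = 0%E.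
  apply: uh_sol; split=> // x [Lx Ox].
  by rewrite clement_ext0//; exact: w0.
have sge0 : (0 <= seminorm1 (2 * s) (Q_Omega Omega) (u \- vh)%R)%E.
  by apply: integral_ge0 => z _; rewrite lee_fin mulr_ge0 ?invr_ge0 ?powR_ge0.
rewrite /e_s lee_sqrt; last first.
  by apply: mule_ge0 => //; rewrite lee_fin; do 2 apply: mulr_ge0 => //.
have [fin|] := boolP (seminorm1 (2 * s) (Q_Omega Omega) (u \- vh)%R < +oo)%E.
  have [_ _ _ fw] := wV.
  have := energy_error_le d_gt0 s0 mO mu (measurable_Vh mesh Vuh)
    (measurable_Vh mesh Vvh) fin fw a1 a2.
  move=> le; apply: le_trans (lee_wpmul2l _ le) _; first by rewrite lee_fin.
  by rewrite muleA -EFinM mulrCA mulrA.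
(* With an infinite seminorm the bound is +oo, unless C K = 0, where 0 times +oo is 0. Then the left
   side is 0 as well: [Gs] vanishes if K = 0, and otherwise the factor C is 0. *)
rewrite -leNgt leye_eq => /eqP ->.
have [K_0|Kn0] := eqVneq (K_ds d s) 0.
  rewrite integral0_eq ?mule0 ?K_0 ?mulr0 ?mul0e// => z _.
  have G0 rho : Gs d s rho = 0.
    by apply/eqP; rewrite -normr_le0 -K_0 Gs_le_K.
  by rewrite !G0 subrr mul0r.
have [C_0|Cn0] := eqVneq (C_ds d s) 0; first by rewrite C_0 mulr0 mul0r !mul0e.
have CK : 0 < C_ds d s * K_ds d s by rewrite mulr_gt0// lt0r ?Kn0 ?Cn0.
by rewrite gt0_muley ?leey// lte_fin -mulrA mulr_gt0.
Qed.
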